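(* Let $(X,Y)$ be a bivariate normal random vector with zero mean vector, variances $\sigma_X^2>0$ and $\sigma_Y^2>0$ (with $\sigma_X,\sigma_Y>0$) and correlation coefficient $\rho\in(-1,1)$, and let $Z=XY$. Let $n\geq 1$ be an integer, let $Z_1,\ldots,Z_n$ be independent and identical copies of $Z$, and let $\overline{Z}=\frac{1}{n}(Z_1+\cdots+Z_n)$. Then the probability density function of $\overline{Z}$ is $$p(x)=\frac{n^{(n+1)/2}\,2^{(1-n)/2}\,|x|^{(n-1)/2}}{(\sigma_X\sigma_Y)^{(n+1)/2}\sqrt{\pi(1-\rho^2)}\,\Gamma\left(\frac{n}{2}\right)}\exp\left(\frac{\rho n x}{\sigma_X\sigma_Y(1-\rho^2)}\right)K_{\frac{n-1}{2}}\left(\frac{n|x|}{\sigma_X\sigma_Y(1-\rho^2)}\right),\qquad x\in\mathbb{R}.$$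
   Context: For $x>0$ and $\nu\in\mathbb{R}$, $K_\nu(x)=\int_0^\infty \mathrm{e}^{-x\cosh(t)}\cosh(\nu t)\,\mathrm{d}t$ is the modified Bessel function of the second kind. $\Gamma$ denotes the gamma function. The density is a density with respect to Lebesgue measure, so its value at the single point $x=0$ is immaterial. *)

(* Defs.v *)
From mathcomp Require Export all_boot all_order all_algebra.
From mathcomp Require Export all_classical all_reals all_analysis.

Set Implicit Arguments.
Unset Strict Implicit.
Unset Printing Implicit Defensive.
Import Order.TTheory GRing.Theory Num.Theory.
Import numFieldNormedType.Exports.

Local Open Scope classical_set_scope.
Local Open Scope ring_scope.

Definition cosh {R : realType} (t : R) : R := (expR t + expR (- t)) / 2.

(* The modified Bessel function of the second kind, for x > 0. For x <= 0 the
   integral diverges and the value is junk. *)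
Definition besselK {R : realType} (nu x : R) : R :=
  \int[lebesgue_measure]_(t in `[0, +oo[) (expR (- (x * cosh t)) * cosh (nu * t)).

(* Euler's Gamma function, for s > 0. *)
Definition Gamma {R : realType} (s : R) : R :=
  \int[lebesgue_measure]_(t in `]0, +oo[) (t `^ (s - 1) * expR (- t)).

(* f is a probability density with respect to mu of the law of X under P.
   The law is only compared on measurable sets: elsewhere the value of a
   measure is unconstrained. *)
Definition has_density {d d' : measure_display} {T : measurableType d}
    {T' : measurableType d'} {R : realType} (P : probability T R)
    (mu : set T' -> \bar R) (X : T -> T') (f : T' -> R) : Prop :=
  [/\ measurable_fun [set: T'] f,
      forall x, 0 <= f x &
      forall A : set T', measurable A ->
        pushforward P X A = (\int[mu]_(x in A) (f x)%:E)%E].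

(* Joint density of a nondegenerate bivariate normal vector with means mX, mY,
   standard deviations sX, sY > 0 and correlation rho in ]-1, 1[. *)
Definition binormal_pdf {R : realType} (mX mY sX sY rho : R) (z : R * R) : R :=
  let u := (z.1 - mX) / sX in
  let v := (z.2 - mY) / sY in
  (2 * pi * sX * sY * Num.sqrt (1 - rho ^+ 2))^-1 *
  expR (- ((u ^+ 2 - 2 * rho * u * v + v ^+ 2) / (2 * (1 - rho ^+ 2)))).

Definition bivariate_normal {d : measure_display} {T : measurableType d}
    {R : realType} (P : probability T R) (X Y : {RV P >-> R})
    (mX mY sX sY rho : R) : Prop :=
  has_density P (@lebesgue_measure R \x @lebesgue_measure R)%E
    (fun w => (X w, Y w)) (binormal_pdf mX mY sX sY rho).
Arguments bivariate_normal {d T R} P X Y mX mY sX sY rho.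

(* Equality in law; the two variables may live on different spaces. *)
Definition same_law {d1 d2 d' : measure_display} {T1 : measurableType d1}
    {T2 : measurableType d2} {T' : measurableType d'} {R : realType}
    (P1 : probability T1 R) (X1 : T1 -> T')
    (P2 : probability T2 R) (X2 : T2 -> T') : Prop :=
  forall A : set T', measurable A ->
    pushforward P1 X1 A = pushforward P2 X2 A.

Definition mutually_independent {d d' : measure_display} {T : measurableType d}
    {T' : measurableType d'} {R : realType} {I : finType}
    (P : probability T R) (X : I -> T -> T') : Prop :=
  forall (J : {set I}) (A : I -> set T'), (forall i, measurable (A i)) ->
    P (\bigcap_(i in [set` J]) (X i @^-1` A i)) =
    (\big[*%E/1%E]_(i in J) P (X i @^-1` A i))%E.

(* Main.v *)
Require Import Defs.
From mathcomp Require Import all_boot all_order all_algebra.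
From mathcomp Require Import all_classical all_reals all_analysis.
From mathcomp Require Import measurable_realfun ring lra.
Import Order.TTheory GRing.Theory Num.Theory.
Import numFieldNormedType.Exports.
Local Open Scope classical_set_scope.
Local Open Scope ring_scope.

(** Write [X = sX * U] and [Y = sY * (rho * U + sqrt (1 - rho^2) * V)] with
    [U], [V] independent standard normal variables. Given [U], the product
    [X * Y] is normal, and both its mean and its variance are proportional to
    [tau = U^2 / 2]: they are [m * tau] and [v * tau] with
    [m = 2 rho sX sY] and [v = 2 (1 - rho^2) (sX sY)^2]. As [tau] follows the
    Gamma law of shape 1/2, the law of [X * Y] is a mixture of Gaussian laws of
    parameters [(m tau, v tau)] over a Gamma law of [tau], a so-called
    variance-gamma law ([product_vg_law]).

    Such mixtures are stable under convolution: Gaussian densities of parameters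
    [(m s, v s)] and [(m t, v t)] convolve to the one of parameters
    [(m (s + t), v (s + t))], so that only the mixing laws get convolved, and the
    Gamma laws of shapes [a] and [b] convolve to the one of shape [a + b]
    ([vg_kernel_conv]). Hence the sum of [n] independent copies is the mixture
    over the Gamma law of shape [n / 2] ([sum_vg_law]). In the integral over [tau]
    that gives its density, the substitution [tau = r * exp t], with [r] chosen so
    as to make the exponent symmetric in [t], produces [cosh t] and thus the Bessel
    function ([vg_kernelE]); dividing the sum by [n] rescales the density
    ([density_scaled], [vg_pdf_bessel]).

    All densities are handled with values in the extended reals, where Tonelli's
    theorem holds without integrability conditions, and the finiteness that is
    needed comes from total masses. The law of [X * Y] has mass 1, which gives
    [Gamma (1/2) = sqrt pi] ([gammae_half]); the identity
    [Gamma a * Gamma b = Gamma (a + b) * B (a, b)] in the extended nonnegative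
    reals then makes every [Gamma (k / 2)] finite and positive ([gammaeD]); and
    since the law of the mean has mass 1, the integral that defines the Bessel
    function is finite at almost all the points that matter.

    On the probabilistic side, a partial sum is independent of the family of the
    remaining variables ([partial_sum_independent]); this follows by induction
    from the uniqueness of product measures ([joint_law]). *)

Set Implicit Arguments.
Unset Strict Implicit.

(** * Integrals against laws and changes of variables *)

Section density.
Import HBNNSimple.

(** The identity is the hypothesis when [g] is an indicator; it extends
    to simple functions by linearity and to [g] by monotone convergence. As [f] may
    take the value [+oo], the convergence of the products needs a separate look at the
    points where [g] vanishes. *)
Lemma ge0_integral_density {d : measure_display} {T : measurableType d}
    {R : realType} (mu nu : {measure set T -> \bar R}) (f g : T -> \bar R) :
  measurable_fun [set: T] f -> (forall x, 0 <= f x)%E ->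
  (forall A, measurable A -> nu A = \int[mu]_(x in A) f x)%E ->
  measurable_fun [set: T] g -> (forall x, 0 <= g x)%E ->
  (\int[nu]_x g x = \int[mu]_x (g x * f x))%E.
Proof.
move=> mf f0 nuE mg g0.
pose g_ := nnsfun_approx measurableT mg.
have cvg_g x : EFin \o g_^~ x @ \oo --> g x.
  by apply: cvg_nnsfun_approx => // y _; exact: g0.
have nd_g x : {homo (fun n => (g_ n x)%:E) : m n / (m <= n)%N >-> (m <= n)%E}.
  by move=> m n mn; rewrite lee_fin; exact/lefP/nd_nnsfun_approx.
have nd_gf x : {homo (fun n => (g_ n x)%:E * f x)%E : m n / (m <= n)%N >-> (m <= n)%E}.
  by move=> m n mn; apply: lee_wpmul2r => //; exact: nd_g.
have mgn n : measurable_fun [set: T] (fun x => (g_ n x)%:E).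
  exact/measurable_EFinP.
transitivity (limn (fun n => \int[nu]_x (g_ n x)%:E)%E).
  rewrite -monotone_convergence//.
  - by apply: eq_integral => x _; apply/esym/cvg_lim => //; exact: cvg_g.
  - by move=> n x _; rewrite lee_fin.
transitivity (limn (fun n => \int[mu]_x ((g_ n x)%:E * f x))%E); last first.
  rewrite -monotone_convergence//.
  - apply: eq_integral => x _; apply/cvg_lim => //.
    have [ffin|finf] := boolP (f x \is a fin_num).
      by apply: cvgeZr => //; exact: cvg_g.
    have [g0x|gx_neq0] := eqVneq (g x) 0%E; last first.
      apply: cvgeM; [exact: mule_def_neq0_infty|exact: cvg_g|exact: cvg_cst].
    rewrite g0x mul0e.
    rewrite (_ : (fun n => _) = cst 0%E); first exact: cvg_cst.
    apply/funext => n /=; suff -> : (g_ n x)%:E = 0%E by rewrite mul0e.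
    apply/eqP; rewrite eq_le; apply/andP; split; last by rewrite lee_fin.
    by rewrite -g0x nnsfun_approxE; apply: le_approx => // y _; exact: g0.
  - by move=> n; apply: emeasurable_funM.
  - by move=> n x _; apply: mule_ge0 => //; rewrite lee_fin.
congr (limn _); apply/funext => n.
rewrite integral_nnsfun//= patch_setT sintegralE.
transitivity (\sum_(r \in range (g_ n))
   \int[mu]_x (r%:E * (\1_(g_ n @^-1` [set r]) x)%:E * f x))%E.
  apply: eq_fsbigr => r; rewrite inE => -[y _ gyr].
  have r0 : 0 <= r by rewrite -gyr.
  under eq_integral do rewrite -muleA.
  rewrite ge0_integralZl//; last 2 first.
    by apply: emeasurable_funM => //; apply/measurable_EFinP.
    by move=> x _; apply: mule_ge0.
  rewrite nuE// integral_mkcond; congr (_ * _)%E.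
  by apply: eq_integral => x _; rewrite epatch_indic muleC.
rewrite -ge0_integral_fsum//.
- apply: eq_integral => x _.
  rewrite [in RHS]fimfunE -fsumEFin// ge0_mule_fsuml//.
  by move=> r; rewrite nnfun_muleindic_ge0.
- move=> r; apply: emeasurable_funM => //.
  by apply: emeasurable_funM => //; apply/measurable_EFinP.
- by move=> r x _; apply: mule_ge0 => //; rewrite nnfun_muleindic_ge0.
Qed.

End density.

(** A transfer formula in which the image measure may be any measure that agrees with
    it on measurable sets, in particular Lebesgue measure itself. *)
Lemma ge0_integral_image {d1 d2 : measure_display} {T1 : measurableType d1}
    {T2 : measurableType d2} {R : realType} (mu : {measure set T1 -> \bar R})
    (nu : {measure set T2 -> \bar R}) (h : T1 -> T2) (f : T2 -> \bar R) :
  measurable_fun [set: T1] h ->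
  (forall A, measurable A -> nu A = mu (h @^-1` A)) ->
  measurable_fun [set: T2] f -> (forall x, 0 <= f x)%E ->
  (\int[nu]_x f x = \int[mu]_x f (h x))%E.
Proof.
move=> mh nuE mf f0.
transitivity (\int[mu]_(x in h @^-1` setT) (f \o h) x)%E; last by rewrite preimage_setT.
rewrite -(ge0_integral_pushforward mh)//.
by apply: eq_measure_integral => A mA _; rewrite nuE.
Qed.

(** Lebesgue measure and [a] times its image under [x |-> a * x] agree on bounded
    intervals, hence everywhere. *)
Lemma ge0_integral_scale {R : realType} (a : R) (f : R -> \bar R) :
  0 < a -> measurable_fun [set: R] f -> (forall x, 0 <= f x)%E ->
  (\int[lebesgue_measure]_x f x =
   a%:E * \int[lebesgue_measure]_x f (a * x)%R)%E.
Proof.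
move=> a0 mf f0.
pose h : R -> measurableTypeR R := fun x => a * x.
have mh : measurable_fun [set: measurableTypeR R] h.
  by apply: measurable_funM.
pose a' := NngNum (ltW a0).
rewrite -(preimage_setT h) -[X in (_ = _ * X)%E](ge0_integral_pushforward mh)//.
rewrite -(ge0_integral_mscale _ _ a')//.
  apply: eq_measure_integral => A mA _.
  apply: lebesgue_measure_unique => //= _ [[p q]] _ <-.
  rewrite /mscale /= /pushforward.
  rewrite (_ : _ @^-1` _ = `]p / a, q / a]%classic); last first.
    apply/seteqP; split => x /=; rewrite !in_itv/=;
    by rewrite ltr_pdivrMr// ler_pdivlMr// mulrC.
  rewrite !lebesgue_measure_itv/= !lte_fin ltr_pM2r ?invr_gt0//.
  case: ifP => pq; last by rewrite mule0.
  by rewrite -!EFinB -EFinM; congr EFin; field; rewrite gt_eqF.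
Qed.

Lemma ge0_integral_translation {R : realType} (b : R) (f : R -> \bar R) :
  measurable_fun [set: R] f -> (forall x, 0 <= f x)%E ->
  (\int[lebesgue_measure]_x f x = \int[lebesgue_measure]_x f (x + b)%R)%E.
Proof.
move=> mf f0.
pose h : R -> measurableTypeR R := fun x => x + b.
have mh : measurable_fun [set: measurableTypeR R] h.
  by apply: measurable_funD.
apply: (ge0_integral_image mh) => // A mA.
change (lebesgue_measure A = pushforward lebesgue_measure h A).
apply: lebesgue_measure_unique => //= _ [[p q]] _ <-.
rewrite /pushforward (_ : _ @^-1` _ = `]p - b, q - b]%classic); last first.
  by apply/seteqP; split => x /=; rewrite !in_itv/= ltrBlDr lerBrDr.
rewrite !lebesgue_measure_itv/= !lte_fin ltrD2r.
case: ifP => // pq.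
by rewrite -!EFinB; congr EFin; ring.
Qed.

Lemma ge0_integral_reflection {R : realType} (f : R -> \bar R) :
  measurable_fun [set: R] f -> (forall x, 0 <= f x)%E ->
  (\int[lebesgue_measure]_x f x = \int[lebesgue_measure]_x f (- x)%R)%E.
Proof.
move=> mf f0.
have mN : measurable_fun [set: measurableTypeR R] (-%R : R -> measurableTypeR R).
  exact: oppr_measurable.
apply: (ge0_integral_image mN) => // A mA.
exact/esym/lebesgue_measureN.
Qed.

(** On each [[-i, i]] this is the usual substitution on a segment; the general case is
    the limit, since the segments and their images exhaust the line and the half-line. *)
Lemma ge0_integral_expR {R : realType} (G : R -> R) :
  {in `]0, +oo[, continuous G} -> (forall x, 0 < x -> 0 <= G x) ->
  (\int[lebesgue_measure]_(x in `]0%R, +oo[) (G x)%:E =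
   \int[lebesgue_measure]_t (G (expR t) * expR t)%:E)%E.
Proof.
move=> cG G0.
have cGe : continuous (fun t => G (expR t) * expR t).
  move=> t; apply: continuousM; last exact: continuous_expR.
  apply: continuous_comp; first exact: continuous_expR.
  by apply: cG; rewrite in_itv/= andbT expR_gt0.
pose A (i : nat) : set R := `[- i%:R, i%:R]%classic.
pose B (i : nat) : set R := `[expR (- i%:R), expR i%:R]%classic.
have AT : \bigcup_i A i = setT.
  apply/seteqP; split => // x _; exists (Num.bound `|x|) => //=.
  by rewrite /A/= in_itv/= -ler_norml ltW// archi_boundP.
have BT : \bigcup_i B i = `]0, +oo[%classic.
  apply/seteqP; split => x /=.
    move=> [i _]; rewrite /B/= !in_itv/= andbT => /andP[+ _].
    by apply: lt_le_trans; exact: expR_gt0.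
  rewrite in_itv/= andbT => x0.
  have : (\bigcup_i A i) (ln x) by rewrite AT.
  move=> [i _]; rewrite /A/= in_itv/= => /andP[xi ix]; exists i => //.
  by rewrite /B/= in_itv/= -[x]lnK// !ler_expR xi.
have ndA : {homo A : n m / (n <= m)%N >-> (n <= m)%O}.
  move=> m n mn; apply/subsetPset; apply: subset_itv; rewrite bnd_simp ?lerN2 ler_nat//.
have ndB : {homo B : n m / (n <= m)%N >-> (n <= m)%O}.
  by move=> m n mn; apply/subsetPset; apply: subset_itv; rewrite bnd_simp ler_expR ?lerN2 ler_nat.
have mG : measurable_fun (`]0, +oo[%classic : set R) G.
  by apply: open_continuous_measurable_fun; [exact: interval_open|move=> x /set_mem; exact: cG].
have BS i : B i `<=` `]0, +oo[.
  by rewrite -BT; exact: bigcup_sup.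
have mA i : measurable (A i) by exact: measurable_itv.
have mB i : measurable (B i) by exact: measurable_itv.
have cvgB : (\int[lebesgue_measure]_(x in B i) (G x)%:E)%E @[i --> \oo] -->
    (\int[lebesgue_measure]_(x in \bigcup_i B i) (G x)%:E)%E.
  apply: ge0_nondecreasing_set_cvg_integral => //.
  by move=> i; apply/measurable_EFinP; apply: measurable_funS mG.
  move=> i x /BS; rewrite /= in_itv/= andbT lee_fin; exact: G0.
have cvgA : (\int[lebesgue_measure]_(t in A i) (G (expR t) * expR t)%:E)%E @[i --> \oo] -->
    (\int[lebesgue_measure]_(t in \bigcup_i A i) (G (expR t) * expR t)%:E)%E.
  apply: ge0_nondecreasing_set_cvg_integral => //.
  move=> i; apply/measurable_EFinP; apply: measurable_funTS.
  exact: continuous_measurable_fun.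
  by move=> i x _; rewrite lee_fin mulr_ge0 ?expR_ge0// G0 ?expR_gt0.
have derE : (@expR R)^`()%classic = expR.
  by apply/funext => x; rewrite derive1E derive_val.
have BA i : (\int[lebesgue_measure]_(x in B i) (G x)%:E =
    \int[lebesgue_measure]_(t in A i) (G (expR t) * expR t)%:E)%E.
  have NiI : (- i%:R <= i%:R :> R) by rewrite (le_trans _ (ler0n _ i))// oppr_le0.
  rewrite integration_by_substitution_increasing//.
  - by rewrite derE.
  - by move=> x y _ _; rewrite ltr_expR.
  - by rewrite derE => x _; exact: continuous_expR.
  - rewrite derE; apply/cvg_ex; exists (expR (- i%:R)).
    by apply: cvg_at_right_filter; exact: continuous_expR.
  - rewrite derE; apply/cvg_ex; exists (expR i%:R).
    by apply: cvg_at_left_filter; exact: continuous_expR.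
  - split.
    + by move=> x _; exact: derivable_expR.
    + by apply: cvg_at_right_filter; exact: continuous_expR.
    + by apply: cvg_at_left_filter; exact: continuous_expR.
  - apply: continuous_in_subspaceT => x /set_mem /BS /=; exact: cG.
move: cvgB; under eq_fun do rewrite BA; move=> cvgB.
by rewrite -BT -[in RHS]AT; exact: (cvg_unique _ cvgB cvgA).
Qed.

Lemma ge0_integral_even {R : realType} (G : R -> \bar R) :
  measurable_fun [set: R] G -> (forall x, 0 <= G x)%E -> (forall x, G (- x) = G x) ->
  (\int[lebesgue_measure]_x G x =
   2%:E * \int[lebesgue_measure]_(x in `]0%R, +oo[) G x)%E.
Proof.
move=> mG G0 GN.
have -> : [set: R] = `]-oo, 0%R] `|` `]0%R, +oo[ :> set R.
  by apply/seteqP; split => // x _ /=; rewrite !in_itv/= andbT; have [] := leP x 0; [left|right].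
rewrite ge0_integral_setU//=; last 2 first.
- exact: measurable_funTS.
- rewrite disj_set2E; apply/eqP; rewrite -subset0 => x []/=.
  by rewrite !in_itv/= andbT leNgt => /negP.
have -> : (\int[lebesgue_measure]_(x in `]-oo, 0%R]) G x =
    \int[lebesgue_measure]_(x in `]0%R, +oo[) G x)%E.
  rewrite integral_itv_obnd_cbnd; last exact: measurable_funTS.
  rewrite ge0_integration_by_substitution0//.
  by apply: eq_integral => x _; rewrite GN.
by rewrite mule_natl mule2n.
Qed.

(** * Measurability and iterated integrals *)

Section measurability.
Context {d : measure_display} {T : measurableType d} {R : realType}.

(** The power function yields the inverse at nonnegative arguments only, hence the identity
    [x^-1 = x * (x^2)^-1], which also holds at 0. *)
Lemma measurable_funV (f : T -> R) :
  measurable_fun [set: T] f -> measurable_fun [set: T] (fun x => (f x)^-1).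
Proof.
move=> mf; rewrite (_ : (fun x => _) = fun x => f x * (f x * f x) `^ (- 1)).
  apply: measurable_funM => //.
  have mff := measurable_funM mf mf.
  have mp := measurableT_comp (measurable_powR (-1)) mff.
  exact: mp.
apply/funext => x; rewrite powR_inv1 -?expr2 ?sqr_ge0//.
have [->|fx0] := eqVneq (f x) 0; first by rewrite invr0 mul0r.
by rewrite expr2 invfM mulVKf.
Qed.

Lemma measurable_fun_sqrt (f : T -> R) :
  measurable_fun [set: T] f -> measurable_fun [set: T] (fun x => Num.sqrt (f x)).
Proof.
apply: measurableT_comp.
apply: nondecreasing_measurable => // x y xy; exact: ler_wsqrtr.
Qed.

Lemma measurable_ge0_integral (f : T -> R -> \bar R) :
  measurable_fun [set: T * R] (fun z => f z.1 z.2) ->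
  (forall x y, 0 <= f x y)%E ->
  measurable_fun [set: T] (fun x => \int[lebesgue_measure]_y f x y)%E.
Proof.
move=> mf f0.
exact: (measurable_fun_fubini_tonelli_F (m2 := lebesgue_measure) (fun z => f z.1 z.2)).
Qed.

End measurability.

Lemma ge0_integral_swap {R : realType} (f : R -> R -> \bar R) :
  measurable_fun [set: R * R] (fun z => f z.1 z.2) ->
  (forall x y, 0 <= f x y)%E ->
  (\int[lebesgue_measure]_x \int[lebesgue_measure]_y f x y =
   \int[lebesgue_measure]_y \int[lebesgue_measure]_x f x y)%E.
Proof.
move=> mf f0.
exact: (fubini_tonelli (m1 := lebesgue_measure) (m2 := lebesgue_measure) (fun z => f z.1 z.2)).
Qed.

(** * Gaussian densities *)

Section gauss_pdf.
Context {R : realType}.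
Implicit Types m v x y : R.

Definition gauss_pdf m v x : R :=
  (Num.sqrt (2 * pi * v))^-1 * expR (- ((x - m) ^+ 2 / (2 * v))).

Lemma gauss_pdf_ge0 m v x : 0 <= gauss_pdf m v x.
Proof. by rewrite mulr_ge0 ?expR_ge0// invr_ge0 sqrtr_ge0. Qed.

Lemma measurable_gauss_pdf {d : measure_display} {T : measurableType d}
    (m v x : T -> R) :
  measurable_fun [set: T] m -> measurable_fun [set: T] v ->
  measurable_fun [set: T] x ->
  measurable_fun [set: T] (fun w => gauss_pdf (m w) (v w) (x w)).
Proof.
move=> mm mv mx; apply: measurable_funM.
  by apply/measurable_funV/measurable_fun_sqrt/measurable_funM.
apply: measurableT_comp => //; apply: measurable_funN.
apply: measurable_funM; first by apply/measurable_funX/measurable_funB.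
by apply/measurable_funV/measurable_funM.
Qed.

Lemma integral_gauss_pdf m v : 0 < v ->
  (\int[lebesgue_measure]_x (gauss_pdf m v x)%:E = 1)%E.
Proof.
move=> v0; rewrite -(integral_normal_pdf m (Num.sqrt v)).
apply: eq_integral => x _; congr EFin.
rewrite normal_pdfE ?gt_eqF ?sqrtr_gt0// /normal_peak /normal_fun.
rewrite sqr_sqrtr ?ltW// /gauss_pdf; congr ((Num.sqrt _)^-1 * expR _).
  by rewrite mulr2n; ring.
by rewrite mulNr mulr_natl.
Qed.

(** Completing the square in [x]: the second factor on the right is the conditional
    density of one summand given that the sum is [y]. *)
Lemma gauss_pdfM m1 v1 m2 v2 x y : 0 < v1 -> 0 < v2 ->
  gauss_pdf m1 v1 x * gauss_pdf m2 v2 (y - x) =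
  gauss_pdf (m1 + m2) (v1 + v2) y *
  gauss_pdf (((y - m2) * v1 + m1 * v2) / (v1 + v2)) (v1 * v2 / (v1 + v2)) x.
Proof.
move=> v10 v20; have v12 : 0 < v1 + v2 by exact: addr_gt0.
rewrite /gauss_pdf [LHS]mulrACA [RHS]mulrACA -!expRD -!invfM -!sqrtrM; last 2 first.
  by rewrite !mulr_ge0// ?pi_ge0// ltW.
  by rewrite !mulr_ge0// ?pi_ge0// ltW.
congr ((Num.sqrt _)^-1 * expR _).
  by field; rewrite gt_eqF.
by field; rewrite !gt_eqF.
Qed.

Lemma gauss_pdf_conv m1 v1 m2 v2 y : 0 < v1 -> 0 < v2 ->
  (\int[lebesgue_measure]_x (gauss_pdf m1 v1 x * gauss_pdf m2 v2 (y - x))%:E =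
   (gauss_pdf (m1 + m2) (v1 + v2) y)%:E)%E.
Proof.
move=> v10 v20; under eq_integral do rewrite gauss_pdfM// EFinM.
rewrite ge0_integralZl//.
- by rewrite integral_gauss_pdf ?mule1// !divr_gt0// ?mulr_gt0 ?addr_gt0.
- by apply/measurable_EFinP; apply: measurable_gauss_pdf.
- by move=> x _; rewrite lee_fin gauss_pdf_ge0.
- by rewrite lee_fin gauss_pdf_ge0.
Qed.

End gauss_pdf.

(** * Convolution of densities on the line *)

Definition convolution {R : realType} (f g : R -> \bar R) (y : R) : \bar R :=
  (\int[lebesgue_measure]_x (f x * g (y - x)%R))%E.

Lemma measurable_conv_integrand {R : realType} (f g : R -> \bar R) :
  measurable_fun [set: R] f -> measurable_fun [set: R] g ->
  measurable_fun [set: R * R] (fun z => f z.2 * g (z.1 - z.2)%R)%E.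
Proof.
move=> mf mg; apply: emeasurable_funM.
  exact: (measurableT_comp mf).
apply: (measurableT_comp mg).
exact: measurable_funB.
Qed.

Lemma integral_convolution {R : realType} (f g : R -> \bar R) :
  measurable_fun [set: R] f -> measurable_fun [set: R] g ->
  (forall x, 0 <= f x)%E -> (forall x, 0 <= g x)%E ->
  (\int[lebesgue_measure]_y convolution f g y =
   (\int[lebesgue_measure]_x f x) * (\int[lebesgue_measure]_x g x))%E.
Proof.
move=> mf mg f0 g0; rewrite /convolution ge0_integral_swap; last 2 first.
  exact: measurable_conv_integrand.
  by move=> x y; exact: mule_ge0.
rewrite -ge0_integralZr//; last by apply: integral_ge0.
apply: eq_integral => x _; rewrite ge0_integralZl//.
  by rewrite -(ge0_integral_translation (f := g) (- x)).
  by apply: (measurableT_comp mg); exact: measurable_funB.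
Qed.

(** * Gamma and beta integrals *)

(** In the extended reals, no nonnegative factor of a positive real number can be
    0 or infinite. *)
Lemma mule_gt0_fin_num {R : realType} (x y : \bar R) (r : R) :
  (0 <= x)%E -> (0 <= y)%E -> 0 < r -> (x * y = r%:E)%E ->
  exists2 s, 0 < s & x = s%:E.
Proof.
move=> x0 y0 r0 xyr; have xy0 : (x * y != 0)%E by rewrite xyr eqe gt_eqF.
have xn0 : x != 0%E by apply: contra_neq xy0 => ->; rewrite mul0e.
have yn0 : y != 0%E by apply: contra_neq xy0 => ->; rewrite mule0.
case: x x0 xyr xn0 {xy0} => [s|_|//]; last first.
  by rewrite gt0_mulye ?lt0e ?yn0.
by rewrite lee_fin eqe => s0 _ sn0; exists s; rewrite // lt0r sn0.
Qed.

Section gamma_kernel.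
Context {R : realType}.
Implicit Types a b t y : R.

(** The unnormalized Gamma density of shape [a], extended by 0 to the line so that all
    integrals run over the line and translations apply. *)
Definition gamma_kernel a t : R := \1_(`]0, +oo[ : set R) t * (t `^ (a - 1) * expR (- t)).

Definition beta_kernel a b t : R :=
  \1_(`]0, 1[ : set R) t * (t `^ (a - 1) * (1 - t) `^ (b - 1)).

(** The values of the Gamma and beta functions in the extended reals: no convergence has
    to be known in order to compute with them. *)
Definition gammae a : \bar R := (\int[lebesgue_measure]_t (gamma_kernel a t)%:E)%E.

Definition betae a b : \bar R := (\int[lebesgue_measure]_t (beta_kernel a b t)%:E)%E.

Lemma gamma_kernel_ge0 a t : 0 <= gamma_kernel a t.
Proof. by rewrite !mulr_ge0 ?powR_ge0 ?expR_ge0. Qed.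

Lemma gamma_kernel_gt0E a t : 0 < t -> gamma_kernel a t = t `^ (a - 1) * expR (- t).
Proof. by move=> t0; rewrite /gamma_kernel indicE mem_set ?mul1r//= in_itv/= t0. Qed.

Lemma gamma_kernel_le0 a t : t <= 0 -> gamma_kernel a t = 0.
Proof.
move=> t0; rewrite /gamma_kernel indicE memNset ?mul0r//= in_itv/= andbT.
by rewrite ltNge t0.
Qed.

Lemma measurable_gamma_kernel a : measurable_fun [set: R] (gamma_kernel a).
Proof.
apply: measurable_funM; first exact: measurable_indic.
by apply: measurable_funM => //; apply: measurableT_comp.
Qed.

Lemma beta_kernel_ge0 a b t : 0 <= beta_kernel a b t.
Proof. by rewrite !mulr_ge0 ?powR_ge0. Qed.

Lemma beta_kernel_in a b t : 0 < t < 1 ->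
  beta_kernel a b t = t `^ (a - 1) * (1 - t) `^ (b - 1).
Proof. by move=> t01; rewrite /beta_kernel indicE mem_set ?mul1r//= in_itv/= t01. Qed.

Lemma beta_kernel_out a b t : t <= 0 \/ 1 <= t -> beta_kernel a b t = 0.
Proof.
move=> t01; rewrite /beta_kernel indicE memNset ?mul0r//= in_itv/= => /andP[].
by move=> t0 t1; case: t01; apply/negP; rewrite -ltNge.
Qed.

Lemma measurable_beta_kernel a b : measurable_fun [set: R] (beta_kernel a b).
Proof.
apply: measurable_funM; first exact: measurable_indic.
apply: measurable_funM => //.
by apply: (measurableT_comp (measurable_powR (b - 1))); exact: measurable_funB.
Qed.

Lemma GammaE a : Gamma a = fine (gammae a).
Proof.
rewrite /Gamma /Rintegral integral_mkcond; congr fine.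
by apply: eq_integral => t _; rewrite patchE /gamma_kernel indicE; case: ifP; rewrite ?mul1r ?mul0r.
Qed.

(** Substituting [x = y * t] in the convolution integral takes [y] out of it. *)
Lemma gamma_kernel_conv a b y :
  convolution (EFin \o gamma_kernel a) (EFin \o gamma_kernel b) y =
  ((gamma_kernel (a + b) y)%:E * betae a b)%E.
Proof.
rewrite /convolution /=; have [y0|y0] := leP y 0.
  rewrite (gamma_kernel_le0 _ y0) mul0e integral0_eq// => t _.
  rewrite -EFinM; have [t0|t0] := leP t 0; first by rewrite gamma_kernel_le0// mul0r.
  by rewrite (gamma_kernel_le0 b) ?mulr0//; lra.
rewrite (ge0_integral_scale y0); last 2 first.
- apply: emeasurable_funM; apply/measurable_EFinP; first exact: measurable_gamma_kernel.
  by apply: (measurableT_comp (measurable_gamma_kernel b)); exact: measurable_funB.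
- by move=> t; rewrite -EFinM lee_fin mulr_ge0 ?gamma_kernel_ge0.
rewrite -!ge0_integralZl//; first last.
- by rewrite lee_fin ltW.
- by move=> t _; rewrite -EFinM lee_fin mulr_ge0 ?gamma_kernel_ge0.
- apply: emeasurable_funM; apply/measurable_EFinP;
    apply: (measurableT_comp (measurable_gamma_kernel _)).
    exact: measurable_funM.
  by apply: measurable_funB => //; exact: measurable_funM.
- by rewrite lee_fin gamma_kernel_ge0.
- by move=> t _; rewrite lee_fin beta_kernel_ge0.
- by apply/measurable_EFinP; exact: measurable_beta_kernel.
apply: eq_integral => t _; rewrite -!EFinM; congr EFin.
rewrite (gamma_kernel_gt0E _ y0).
have [t0|t0] := leP t 0.
  rewrite gamma_kernel_le0 ?pmulr_rle0// beta_kernel_out; first by rewrite !(mul0r, mulr0).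
  by left.
have [t1|t1] := leP 1 t.
  rewrite (@gamma_kernel_le0 b); last first.
    by rewrite subr_le0 ler_peMr// ltW.
  by rewrite beta_kernel_out; [rewrite !mulr0|right].
rewrite beta_kernel_in ?t0//.
have yt : y - y * t = y * (1 - t) by ring.
rewrite !gamma_kernel_gt0E ?yt ?mulr_gt0 ?subr_gt0//.
rewrite !powRM ?subr_ge0 ?ltW// -!mulrA.
rewrite (_ : a + b - 1 = 1 + (a - 1) + (b - 1)); last by ring.
have yD r s : y `^ (r + s) = y `^ r * y `^ s.
  by rewrite powRD// (gt_eqF y0) implybT.
rewrite !yD powRr1 ?ltW//.
rewrite (_ : - y = - (y * t) + - (y * (1 - t))); last by ring.
rewrite expRD; ring.
Qed.

(** Both sides are the total mass of the convolution of two Gamma kernels. *)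
Lemma gammaeM a b : (gammae a * gammae b = gammae (a + b) * betae a b)%E.
Proof.
have mG c : measurable_fun [set: R] (EFin \o gamma_kernel c).
  by apply/measurable_EFinP; exact: measurable_gamma_kernel.
have G0 c x : (0 <= (EFin \o gamma_kernel c) x)%E.
  by rewrite lee_fin gamma_kernel_ge0.
rewrite [LHS](_ : _ = \int[lebesgue_measure]_y
  convolution (EFin \o gamma_kernel a) (EFin \o gamma_kernel b) y)%E; last first.
  by rewrite integral_convolution.
under eq_integral do rewrite gamma_kernel_conv.
rewrite ge0_integralZr//.
- exact: mG.
- by move=> x _; exact: (G0 (a + b)).
- by apply: integral_ge0 => x _; rewrite lee_fin beta_kernel_ge0.
Qed.

Lemma gammae_ge0 a : (0 <= gammae a)%E.
Proof. by apply: integral_ge0 => t _; rewrite lee_fin gamma_kernel_ge0. Qed.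

Lemma betae_ge0 a b : (0 <= betae a b)%E.
Proof. by apply: integral_ge0 => t _; rewrite lee_fin beta_kernel_ge0. Qed.

(** Finiteness of [Gamma (a + b)] and of [B (a, b)] is read off the product formula. *)
Lemma gammaeD a b (ga gb : R) : 0 < ga -> 0 < gb ->
  gammae a = ga%:E -> gammae b = gb%:E ->
  exists2 g, 0 < g & gammae (a + b) = g%:E /\ betae a b = (ga * gb / g)%:E.
Proof.
move=> ga0 gb0 Ga Gb; have := gammaeM a b; rewrite Ga Gb -EFinM => /esym GB.
have [g g0 gE] := mule_gt0_fin_num (gammae_ge0 _) (betae_ge0 a b) (mulr_gt0 ga0 gb0) GB.
exists g => //; split => //.
move: GB; rewrite muleC => GB.
have [s s0 sE] := mule_gt0_fin_num (betae_ge0 _ _) (gammae_ge0 (a + b)) (mulr_gt0 ga0 gb0) GB.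
move: GB; rewrite gE sE => -[<-]; congr EFin.
by rewrite mulfK// gt_eqF.
Qed.

Lemma gammae_half_nat k : gammae (2^-1 : R) = (Num.sqrt pi)%:E ->
  exists2 g, 0 < g & gammae (k.+1%:R / 2 : R) = g%:E.
Proof.
move=> G1; have spi : 0 < Num.sqrt (pi : R) by rewrite sqrtr_gt0 pi_gt0.
elim: k => [|k [g g0 gE]]; first by exists (Num.sqrt pi); rewrite ?div1r.
have [g' g'0 [g'E _]] := gammaeD g0 spi gE G1.
by exists g' => //; rewrite -g'E; congr gammae; rewrite -[in LHS]natr1 mulrDl div1r.
Qed.

End gamma_kernel.

(** * Variance-gamma kernels *)

Section variance_gamma.
Context {R : realType}.
Implicit Types a b m v x y t : R.

(** The mixture of the Gaussian densities of mean [m * t] and variance [v * t] over the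
    Gamma kernel in [t]; up to normalization, a variance-gamma density. *)
Definition vg_kernel a m v x : \bar R :=
  (\int[lebesgue_measure]_t (gamma_kernel a t * gauss_pdf (m * t) (v * t) x)%:E)%E.

Let vg_integrand_ge0 a m v t x :
  (0 <= (gamma_kernel a t * gauss_pdf (m * t) (v * t) x)%:E)%E.
Proof. by rewrite lee_fin mulr_ge0 ?gamma_kernel_ge0 ?gauss_pdf_ge0. Qed.

Let measurable_vg_integrand {d : measure_display} {T : measurableType d} a m v (t x : T -> R) :
  measurable_fun [set: T] t -> measurable_fun [set: T] x ->
  measurable_fun [set: T]
    (fun w => (gamma_kernel a (t w) * gauss_pdf (m * t w) (v * t w) (x w))%:E).
Proof.
move=> mt mx; apply/measurable_EFinP; apply: measurable_funM.
  exact: (measurableT_comp (measurable_gamma_kernel a)).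
by apply: measurable_gauss_pdf => //; exact: measurable_funM.
Qed.

Lemma vg_kernel_ge0 a m v x : (0 <= vg_kernel a m v x)%E.
Proof. by apply: integral_ge0 => t _; exact: vg_integrand_ge0. Qed.

Lemma measurable_vg_kernel a m v : measurable_fun [set: R] (vg_kernel a m v).
Proof.
by apply: measurable_ge0_integral => //; exact: measurable_vg_integrand.
Qed.

Lemma integral_vg_kernel a m v : 0 < v ->
  (\int[lebesgue_measure]_x vg_kernel a m v x = gammae a)%E.
Proof.
move=> v0; rewrite /vg_kernel ge0_integral_swap//; last exact: measurable_vg_integrand.
apply: eq_integral => t _; under eq_integral do rewrite EFinM.
rewrite ge0_integralZl//; last 3 first.
- by apply/measurable_EFinP; exact: measurable_gauss_pdf.
- by move=> x _; rewrite lee_fin gauss_pdf_ge0.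
- by rewrite lee_fin gamma_kernel_ge0.
have [t0|t0] := leP t 0; first by rewrite gamma_kernel_le0 ?mul0e.
by rewrite integral_gauss_pdf ?mule1// mulr_gt0.
Qed.

(** By Tonelli, the two mixing integrals can be taken outside of the convolution in
    [y], which then acts on Gaussian densities only and leaves a function of the sum
    [u] of the mixing parameters; what remains is a convolution of Gamma kernels. *)
Lemma vg_kernel_conv a b m v x : 0 < v ->
  convolution (vg_kernel a m v) (vg_kernel b m v) x =
  (betae a b * vg_kernel (a + b) m v x)%E.
Proof.
move=> v0.
pose A s y := (gamma_kernel a s * gauss_pdf (m * s) (v * s) y)%:E.
pose B s y := (gamma_kernel b s * gauss_pdf (m * s) (v * s) y)%:E.
have A0 s y : (0 <= A s y)%E by exact: vg_integrand_ge0.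
have B0 s y : (0 <= B s y)%E by exact: vg_integrand_ge0.
have mK d (T : measurableType d) c (f : T -> R) : measurable_fun [set: T] f ->
    measurable_fun [set: T] (fun w => gamma_kernel c (f w)).
  exact: (measurableT_comp (measurable_gamma_kernel c)).
have K0 c t : 0 <= gamma_kernel c t by exact: gamma_kernel_ge0.
transitivity (\int[lebesgue_measure]_y \int[lebesgue_measure]_s
    (A s y * vg_kernel b m v (x - y)%R))%E.
  apply: eq_integral => y _; rewrite ge0_integralZr//.
  - exact: measurable_vg_integrand.
  - exact: vg_kernel_ge0.
have mBx : measurable_fun [set: R] (fun y => vg_kernel b m v (x - y)).
  by apply: (measurableT_comp (measurable_vg_kernel b m v)); exact: measurable_funB.
rewrite ge0_integral_swap; last 2 first.
- apply: emeasurable_funM; first exact: measurable_vg_integrand.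
  exact: (measurableT_comp mBx).
- by move=> y s; rewrite mule_ge0// vg_kernel_ge0.
transitivity (\int[lebesgue_measure]_s \int[lebesgue_measure]_y \int[lebesgue_measure]_t
    (A s y * B t (x - y)%R))%E.
  apply: eq_integral => s _; apply: eq_integral => y _; rewrite ge0_integralZl//.
  exact: measurable_vg_integrand.
transitivity (\int[lebesgue_measure]_s \int[lebesgue_measure]_t
    ((gamma_kernel a s * gamma_kernel b t) *
      gauss_pdf (m * (s + t)) (v * (s + t)) x)%:E)%E.
  apply: eq_integral => s _; rewrite ge0_integral_swap; last 2 first.
  - apply: emeasurable_funM; first exact: measurable_vg_integrand.
    by apply: measurable_vg_integrand => //; exact: measurable_funB.
  - by move=> y t; exact: mule_ge0.
  apply: eq_integral => t _.
  transitivity (\int[lebesgue_measure]_y ((gamma_kernel a s * gamma_kernel b t)%:E *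
     (gauss_pdf (m * s) (v * s) y * gauss_pdf (m * t) (v * t) (x - y)%R)%:E))%E.
    by apply: eq_integral => y _; rewrite /A /B -!EFinM mulrACA.
  rewrite ge0_integralZl//; last 3 first.
  - apply/measurable_EFinP; apply: measurable_funM; first exact: measurable_gauss_pdf.
    by apply: measurable_gauss_pdf => //; exact: measurable_funB.
  - by move=> y _; rewrite lee_fin mulr_ge0 ?gauss_pdf_ge0.
  - by rewrite lee_fin mulr_ge0 ?gamma_kernel_ge0.
  have [s0|s0] := leP s 0; first by rewrite (gamma_kernel_le0 _ s0) !mul0r mul0e.
  have [t0|t0] := leP t 0; first by rewrite (gamma_kernel_le0 _ t0) mulr0 !mul0r mul0e.
  by rewrite gauss_pdf_conv ?mulr_gt0// -EFinM !mulrDr.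
transitivity (\int[lebesgue_measure]_s \int[lebesgue_measure]_u
    ((gamma_kernel a s * gamma_kernel b (u - s)) *
      gauss_pdf (m * u) (v * u) x)%:E)%E.
  apply: eq_integral => s _.
  rewrite (ge0_integral_translation (- s)); last 2 first.
  - apply/measurable_EFinP; apply: measurable_funM.
      by apply: measurable_funM => //; exact: mK.
    by apply: measurable_gauss_pdf => //; apply: measurable_funM => //; exact: measurable_funD.
  - by move=> t; rewrite lee_fin; apply: mulr_ge0; [exact: mulr_ge0|exact: gauss_pdf_ge0].
  by apply: eq_integral => u _; rewrite subrKC.
rewrite ge0_integral_swap; last 2 first.
- apply/measurable_EFinP; apply: measurable_funM.
    by apply: measurable_funM; apply: mK => //; exact: measurable_funB.
  by apply: measurable_gauss_pdf => //; exact: measurable_funM.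
- by move=> s u; rewrite lee_fin; apply: mulr_ge0; [exact: mulr_ge0|exact: gauss_pdf_ge0].
transitivity (\int[lebesgue_measure]_u
   ((gauss_pdf (m * u) (v * u) x)%:E *
   convolution (EFin \o gamma_kernel a) (EFin \o gamma_kernel b) u))%E.
  apply: eq_integral => u _; rewrite -ge0_integralZl//; last 3 first.
  - apply: emeasurable_funM; apply/measurable_EFinP; apply: mK => //.
    exact: measurable_funB.
  - by move=> s _; rewrite -EFinM lee_fin mulr_ge0.
  - by rewrite lee_fin gauss_pdf_ge0.
  by apply: eq_integral => s _; rewrite -!EFinM mulrC.
under eq_integral do rewrite gamma_kernel_conv muleA [X in (X * _)%E]muleC muleC -EFinM.
rewrite ge0_integralZl//; first exact: measurable_vg_integrand.
by apply: integral_ge0 => t _; rewrite lee_fin beta_kernel_ge0.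
Qed.

End variance_gamma.

(** * The modified Bessel function of the second kind *)

Section bessel.
Context {R : realType}.
Implicit Types (nu x t r k : R).

(** The integral before truncation of an infinite value to 0. *)
Definition besselKe nu x : \bar R :=
  (\int[lebesgue_measure]_(t in `[0%R, +oo[) (expR (- (x * cosh t)) * cosh (nu * t))%:E)%E.

Lemma besselKE nu x : besselK nu x = fine (besselKe nu x).
Proof. by []. Qed.

Lemma continuous_cosh : continuous (@cosh R).
Proof.
move=> t; apply: cvgM; last exact: cvg_cst.
apply: cvgD; first exact: continuous_expR.
by apply: continuous_comp; [exact: opp_continuous|exact: continuous_expR].
Qed.

Lemma cvg_expR_comp (f : R -> R) t : f x @[x --> t] --> f t ->
  expR (f x) @[x --> t] --> expR (f t).
Proof. by move=> cf; apply: (cvg_comp _ _ cf); exact: continuous_expR. Qed.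

Lemma coshN t : cosh (- t) = cosh t.
Proof. by rewrite /cosh opprK addrC. Qed.

Lemma cosh_ge0 t : 0 <= cosh t.
Proof. by rewrite /cosh divr_ge0// addr_ge0// expR_ge0. Qed.

Lemma measurable_besselK_kernel {d : measure_display} {T : measurableType d} nu (x t : T -> R) :
  measurable_fun [set: T] x -> measurable_fun [set: T] t ->
  measurable_fun [set: T] (fun w => expR (- (x w * cosh (t w))) * cosh (nu * t w)).
Proof.
have mc (f : T -> R) : measurable_fun [set: T] f -> measurable_fun [set: T] (fun w => cosh (f w)).
  by apply: measurableT_comp; exact: continuous_measurable_fun continuous_cosh.
move=> mx mt; apply: measurable_funM; last by apply: mc; exact: measurable_funM.
apply: measurableT_comp => //; apply: measurable_funN; apply: measurable_funM => //.
exact: mc.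
Qed.

Lemma measurable_besselK nu : measurable_fun [set: R] (besselK nu).
Proof.
have mI : measurable_fun [set: R] (\1_(`[0, +oo[ : set R) : R -> R).
  exact: measurable_indic.
suff : measurable_fun [set: R] (besselKe nu).
  exact: (measurableT_comp (fine_measurable measurableT)).
rewrite (_ : besselKe nu = fun x => \int[lebesgue_measure]_t
  ((\1_(`[0, +oo[ : set R) t) * (expR (- (x * cosh t)) * cosh (nu * t)))%:E)%E.
  apply: measurable_ge0_integral.
    apply/measurable_EFinP; apply: measurable_funM.
      exact: (measurableT_comp mI).
    exact: measurable_besselK_kernel.
  by move=> x t; rewrite lee_fin !mulr_ge0 ?expR_ge0 ?cosh_ge0.
apply/funext => x; rewrite /besselKe integral_mkcond; apply: eq_integral => t _.
by rewrite patchE indicE; case: ifP; rewrite ?mul1r ?mul0r.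
Qed.

Lemma besselKe_ge0 nu x : (0 <= besselKe nu x)%E.
Proof.
by apply: integral_ge0 => t _; rewrite lee_fin mulr_ge0 ?expR_ge0 ?cosh_ge0.
Qed.

Lemma besselK_ge0 nu x : 0 <= besselK nu x.
Proof. by rewrite besselKE fine_ge0// besselKe_ge0. Qed.

(** The factor [cosh (nu t)] is the even part of [exp (nu t)], and the other factor is
    even. *)
Lemma besselKe_expR nu x :
  (\int[lebesgue_measure]_t (expR (- (x * cosh t)) * expR (nu * t))%:E =
   2%:E * besselKe nu x)%E.
Proof.
have cc b : continuous (fun t => expR (- (x * cosh t)) * expR (b * t)).
  move=> t; apply: cvgM; apply: cvg_expR_comp.
    by apply: cvgN; apply: cvgM; [exact: cvg_cst|exact: continuous_cosh].
  by apply: cvgM; [exact: cvg_cst|exact: cvg_id].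
have mf b : measurable_fun [set: R] (fun t => (expR (- (x * cosh t)) * expR (b * t))%:E).
  by apply/measurable_EFinP; exact: continuous_measurable_fun.
have f0 b t : (0 <= (expR (- (x * cosh t)) * expR (b * t))%:E)%E.
  by rewrite lee_fin mulr_ge0 ?expR_ge0.
have sym : (\int[lebesgue_measure]_t (expR (- (x * cosh t)) * expR (nu * t))%:E =
    \int[lebesgue_measure]_t (expR (- (x * cosh t)) * expR (- nu * t))%:E)%E.
  rewrite (ge0_integral_reflection (mf nu) (f0 nu)); apply: eq_integral => t _.
  by rewrite coshN mulrN mulNr.
have Dsym (f g : R -> \bar R) : measurable_fun [set: R] f -> measurable_fun [set: R] g ->
    (forall t, 0 <= f t)%E -> (forall t, 0 <= g t)%E ->
    (\int[lebesgue_measure]_t f t = \int[lebesgue_measure]_t g t ->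
    \int[lebesgue_measure]_t (f t + g t) = 2%:E * \int[lebesgue_measure]_t f t)%E.
  by move=> mf' mg' f0' g0' fg; rewrite ge0_integralD// -fg mule_natl mule2n.
have KE t : expR (- (x * cosh t)) * cosh (nu * t) =
   2^-1 * (expR (- (x * cosh t)) * expR (nu * t) + expR (- (x * cosh t)) * expR (- nu * t)).
  by rewrite {2}/cosh mulNr; ring.
rewrite /besselKe set_itvcy -ge0_symfun_integralT.
- under [RHS]eq_integral do rewrite KE EFinM EFinD.
  rewrite (ge0_integralZl _ measurableT)//; last 2 first.
    exact: (emeasurable_funD (mf nu) (mf (- nu))).
    by move=> t _; rewrite adde_ge0.
  rewrite (Dsym _ _ (mf nu) (mf (- nu)) (f0 nu) (f0 (- nu)) sym).
  by rewrite muleA -EFinM mulVf ?mul1e ?pnatr_eq0.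
- by move=> t; rewrite mulr_ge0 ?expR_ge0 ?cosh_ge0.
- move=> t; apply: cvgM.
    apply: cvg_expR_comp.
    by apply: cvgN; apply: cvgM; [exact: cvg_cst|exact: continuous_cosh].
  apply: continuous_comp; last exact: continuous_cosh.
  by apply: cvgM; [exact: cvg_cst|exact: cvg_id].
- by move=> t /=; rewrite mulrN !coshN.
Qed.

Lemma measurable_gig nu k r : measurable_fun [set: R]
  (fun t => expR ((nu - 1) * ln t - k / 2 * (t / r + r / t))).
Proof.
apply: measurableT_comp => //; apply: measurable_funB; first exact: measurable_funM.
apply: measurable_funM => //; apply: measurable_funD; first exact: measurable_funM.
by apply: measurable_funM => //; exact: measurable_funV.
Qed.

(** The substitution [t = r * exp u] turns [t / r + r / t] into [2 * cosh u]. *)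
Lemma integral_expR_besselK nu k r : 0 < r ->
  (\int[lebesgue_measure]_(t in `]0%R, +oo[)
     (expR ((nu - 1) * ln t - k / 2 * (t / r + r / t)))%:E =
   (2 * r `^ nu)%:E * besselKe nu k)%E.
Proof.
move=> r0.
pose h t := expR (- (k * cosh t)) * expR (nu * t).
have mh : measurable_fun [set: R] h.
  apply: continuous_measurable_fun => t; apply: cvgM; apply: cvg_expR_comp.
    by apply: cvgN; apply: cvgM; [exact: cvg_cst|exact: continuous_cosh].
  by apply: cvgM; [exact: cvg_cst|exact: cvg_id].
rewrite (mulrC 2) EFinM -muleA -besselKe_expR -ge0_integralZl//; last 2 first.
  exact/measurable_EFinP.
  by rewrite lee_fin powR_ge0.
rewrite ge0_integral_expR; last 2 first.
- move=> x; rewrite in_itv/= andbT => x0; apply: cvg_expR_comp.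
  apply: cvgB; first by apply: cvgM; [exact: cvg_cst|exact: continuous_ln].
  apply: cvgM; first exact: cvg_cst.
  apply: cvgD; first by apply: cvgM; [exact: cvg_id|exact: cvg_cst].
  apply: cvgM; first exact: cvg_cst.
  by apply: cvgV; [rewrite gt_eqF|exact: cvg_id].
- by move=> x _; exact: expR_ge0.
rewrite (ge0_integral_translation (ln r)); last 2 first.
- apply/measurable_EFinP; apply: measurable_funM => //.
  exact: (measurableT_comp (measurable_gig nu k r)).
- by move=> t; rewrite lee_fin mulr_ge0 ?expR_ge0.
apply: eq_integral => t _; rewrite -EFinM; congr EFin.
rewrite expRK /powR gt_eqF// -!expRD; congr expR.
rewrite /cosh expRD lnK// expRN.
have et0 : expR (t : R) != 0 by rewrite gt_eqF ?expR_gt0.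
by field; rewrite et0 gt_eqF.
Qed.

(** The square in the Gaussian exponent, once expanded, leaves a linear term that comes
    out of the integral and a combination of [t] and [1 / t]; the conditions on [k] and
    [r] match its two coefficients. *)
Lemma vg_kernelE (a m v x r k : R) : 0 < v -> 0 < r ->
  k / (2 * r) = 1 + m ^+ 2 / (2 * v) -> k * r / 2 = x ^+ 2 / (2 * v) ->
  (vg_kernel a m v x =
  ((Num.sqrt (2 * pi * v))^-1 * expR (m * x / v) * (2 * r `^ (a - 2^-1)))%:E *
  besselKe (a - 2^-1) k)%E.
Proof.
move=> v0 r0 kr1 kr2.
rewrite EFinM -muleA -integral_expR_besselK// -ge0_integralZl//; last first.
  by apply/measurable_EFinP; apply: measurable_funTS; exact: measurable_gig.
rewrite [RHS]integral_mkcond; apply: eq_integral => t _.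
rewrite patchE /gamma_kernel indicE; case: ifP => t0; last by rewrite !mul0r.
move: t0; rewrite inE/= in_itv/= andbT => t0.
rewrite mul1r -EFinM; congr EFin; rewrite /gauss_pdf.
have -> : (Num.sqrt (2 * pi * (v * t)))^-1 = (Num.sqrt (2 * pi * v))^-1 * (t `^ (- 2^-1)).
  rewrite mulrA sqrtrM ?mulr_ge0 ?pi_ge0 ?(ltW v0)//.
  by rewrite invfM powRN powR12_sqrt// ltW.
rewrite (_ : t `^ (a - 1) * expR (- t) * _ = (Num.sqrt (2 * pi * v))^-1 *
  (t `^ (a - 1) * t `^ (- 2^-1) *
   (expR (- t) * expR (- ((x - m * t) ^+ 2 / (2 * (v * t))))))); last by ring.
rewrite -[RHS]mulrA; congr (_ * _).
rewrite -powRD; last by rewrite (gt_eqF t0) implybT.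
rewrite /powR gt_eqF// -!expRD; congr expR.
have -> : k / 2 * (t / r + r / t) = t * (k / (2 * r)) + (k * r / 2) / t.
  by field; rewrite !gt_eqF.
by rewrite kr1 kr2; field; rewrite !gt_eqF.
Qed.

End bessel.

(** * The product of two correlated normal variables *)

Section product_of_normals.
Context {R : realType} (sX sY rho : R).
Context (sX0 : 0 < sX) (sY0 : 0 < sY) (rho1 : -1 < rho < 1).

Let pdf := binormal_pdf 0 0 sX sY rho.

Let c0 : 0 < 1 - rho ^+ 2.
Proof. by case/andP: rho1 => ? ?; nra. Qed.

Lemma binormal_pdf_ge0 z : 0 <= pdf z.
Proof.
rewrite /pdf /binormal_pdf mulr_ge0 ?expR_ge0// invr_ge0.
by rewrite !mulr_ge0 ?sqrtr_ge0 ?pi_ge0 ?ltW.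
Qed.

Lemma binormal_pdfN x y : pdf (- x, - y) = pdf (x, y).
Proof.
rewrite /pdf /binormal_pdf /= !subr0 ![- _ / _]mulNr.
by rewrite !sqrrN !mulrN mulNr opprK.
Qed.

(** The left side is the density of the product at [z], after folding the half-line
    [x < 0] onto [x > 0]. The two integrals correspond under [t = x^2 / (2 * sX^2)];
    both are written as integrals of the same function over the line through [x = exp t],
    where that correspondence is affine. *)
Lemma product_densityE z :
  (2%:E * \int[lebesgue_measure]_(x in `]0%R, +oo[) (pdf (x, z / x) * x^-1)%:E =
   (Num.sqrt pi)^-1%:E *
    vg_kernel 2^-1 (2 * rho * (sX * sY)) (2 * (1 - rho ^+ 2) * (sX * sY) ^+ 2) z)%E.
Proof.
set m := 2 * rho * _; set v := 2 * _ * _.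
pose C := (2 * pi * sX * sY * Num.sqrt (1 - rho ^+ 2))^-1.
pose E (u : R) := expR (- (u + (z - m * u) ^+ 2 / (2 * v * u))).
have v0 : 0 < v by rewrite !mulr_gt0// exprn_gt0// mulr_gt0.
have L : (\int[lebesgue_measure]_(x in `]0%R, +oo[) (pdf (x, z / x) * x^-1)%:E =
    \int[lebesgue_measure]_t (C * E (expR (2 * t) / (2 * sX ^+ 2)))%:E)%E.
  rewrite ge0_integral_expR; last 2 first.
  - move=> x; rewrite in_itv/= andbT => x0; apply: cvgM; last first.
      by apply: cvgV; [rewrite gt_eqF|exact: cvg_id].
    apply: cvgM; first exact: cvg_cst.
    apply: cvg_expR_comp; apply: cvgN; apply: cvgM; last exact: cvg_cst.
    have cx : (x' - 0) / sX @[x' --> x] --> (x - 0) / sX.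
      by apply: cvgM; last exact: cvg_cst; apply: cvgB; [exact: cvg_id|exact: cvg_cst].
    have cz : (z / x' - 0) / sY @[x' --> x] --> (z / x - 0) / sY.
      apply: cvgM; last exact: cvg_cst; apply: cvgB; last exact: cvg_cst.
      by apply: cvgM; [exact: cvg_cst|apply: cvgV; [rewrite gt_eqF|exact: cvg_id]].
    have sq (f : R -> R) : f u @[u --> x] --> f x -> f u ^+ 2 @[u --> x] --> f x ^+ 2.
      by move=> cf; apply: (cvg_comp f (fun y => y ^+ 2) cf); exact: exprn_continuous.
    apply: cvgD; last exact: sq.
    apply: cvgB; first exact: sq.
    by apply: cvgM => //; apply: cvgM => //; exact: cvg_cst.
  - by move=> x x0; rewrite mulr_ge0 ?binormal_pdf_ge0// invr_ge0 ltW.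
  apply: eq_integral => t _; congr EFin.
  rewrite /pdf /binormal_pdf /= -/C !subr0 -!mulrA mulVf ?gt_eqF ?expR_gt0// mulr1.
  congr (_ * expR _).
  have -> : expR (2 * t : R) = expR t ^+ 2 by rewrite expr2 -expRD; congr expR; ring.
  have et0 : expR (t : R) != 0 by rewrite gt_eqF ?expR_gt0.
  rewrite /m /v; field.
  by rewrite et0 !gt_eqF.
have mE : measurable_fun [set: R] E.
  apply: measurableT_comp => //; apply: measurable_funN; apply: measurable_funD => //.
  apply: measurable_funM; last by apply: measurable_funV; exact: measurable_funM.
  by apply: measurable_funX; apply: measurable_funB => //; exact: measurable_funM.
have E0 u : 0 <= E u by exact: expR_ge0.
have V : (vg_kernel 2^-1 m v z =
    (Num.sqrt (2 * pi * v))^-1%:E * \int[lebesgue_measure]_t (E (expR t))%:E)%E.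
  rewrite -ge0_integralZl//; last 2 first.
  - by apply/measurable_EFinP; exact: measurableT_comp.
  - by move=> t _; rewrite lee_fin.
  rewrite /vg_kernel.
  transitivity (\int[lebesgue_measure]_(t in `]0%R, +oo[)
     ((Num.sqrt (2 * pi * v))^-1 * (E t * t^-1))%:E)%E.
    rewrite [RHS]integral_mkcond; apply: eq_integral => t _.
    rewrite patchE /gamma_kernel indicE; case: ifP => t0; last by rewrite !mul0r.
    move: t0; rewrite inE/= in_itv/= andbT => t0; congr EFin.
    rewrite mul1r /gauss_pdf mulrA sqrtrM; last by rewrite !mulr_ge0 ?pi_ge0 ?ltW.
    rewrite [in LHS]invfM -(powR12_sqrt (ltW t0)) -powRN.
    transitivity ((Num.sqrt (2 * pi * v))^-1 *
      ((t `^ (2^-1 - 1) * t `^ (- 2^-1)) *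
       (expR (- t) * expR (- ((z - m * t) ^+ 2 / (2 * (v * t)))))));
      first by ring.
    rewrite -powRD; last by rewrite (gt_eqF t0) implybT.
    rewrite (_ : 2^-1 - 1 + - 2^-1 = - 1); last by field.
    rewrite powR_inv1 ?(ltW t0)// [in RHS]mulrC.
    by rewrite /E opprD expRD (mulrA 2 v t); ring.
  rewrite ge0_integral_expR; last 2 first.
  - move=> x; rewrite in_itv/= andbT => x0; apply: cvgM; first exact: cvg_cst.
    apply: cvgM; last by apply: cvgV; [rewrite gt_eqF|exact: cvg_id].
    apply: cvg_expR_comp; apply: cvgN; apply: cvgD; first exact: cvg_id.
    apply: cvgM; last first.
      apply: cvgV; first by rewrite gt_eqF// mulr_gt0// mulr_gt0.
      by apply: cvgM; [exact: cvg_cst|exact: cvg_id].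
    apply: (cvg_comp (fun u => z - m * u) (fun y => y ^+ 2)); last exact: exprn_continuous.
    by apply: cvgB; [exact: cvg_cst|apply: cvgM; [exact: cvg_cst|exact: cvg_id]].
  - by move=> x x0; rewrite !mulr_ge0 ?invr_ge0 ?sqrtr_ge0// ltW.
  apply: eq_integral => t _; congr EFin.
  by rewrite -!mulrA mulVf ?mulr1// gt_eqF ?expR_gt0.
have S : (\int[lebesgue_measure]_t (E (expR t))%:E =
    2%:E * \int[lebesgue_measure]_t (E (expR (2 * t) / (2 * sX ^+ 2)))%:E)%E.
  rewrite (ge0_integral_scale (a := 2)); last 3 first.
  - by [].
  - by apply/measurable_EFinP; exact: measurableT_comp.
  - by move=> t; rewrite lee_fin.
  congr (_ * _)%E.
  (* exp (2 * (t - ln (2 sX^2) / 2)) = exp (2 * t) / (2 sX^2) *)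
  rewrite (ge0_integral_translation (- (ln (2 * sX ^+ 2) / 2))); last 2 first.
  - apply/measurable_EFinP; apply: measurableT_comp => //.
    by apply: measurableT_comp => //; exact: measurable_funM.
  - by move=> t; rewrite lee_fin.
  apply: eq_integral => t _; congr (E _)%:E.
  rewrite mulrDr mulrN (mulrC 2 (_ / 2)) divfK// expRD expRN lnK//.
  by rewrite posrE mulr_gt0// exprn_gt0.
rewrite L V S; under eq_integral do rewrite EFinM.
rewrite ge0_integralZl//; last 3 first.
- apply/measurable_EFinP; apply: measurableT_comp => //; apply: measurable_funM => //.
  by apply: measurableT_comp => //; exact: measurable_funM.
- by move=> t _; rewrite lee_fin.
- by rewrite lee_fin invr_ge0 !mulr_ge0 ?sqrtr_ge0 ?pi_ge0 ?ltW.
rewrite [RHS]muleA [RHS]muleA -!EFinM [LHS]muleA -EFinM; congr (_%:E * _)%E.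
rewrite -invfM -sqrtrM ?pi_ge0//.
rewrite (_ : pi * (2 * pi * v) = (2 * pi * sX * sY) ^+ 2 * (1 - rho ^+ 2)); last first.
  by rewrite /v; ring.
rewrite sqrtrM ?sqr_ge0// sqrtr_sqr ger0_norm 1?mulrC//.
by rewrite !mulr_ge0 ?pi_ge0 ?ltW.
Qed.

(** As the density is even in [(x, y)], the outer integral reduces to [x > 0]. There, one
    substitutes [y = z / x] in the inner integral and exchanges the integrals. *)
Lemma product_density (A : set R) : measurable A ->
  measurable_fun [set: R * R] pdf ->
  (\int[@lebesgue_measure R \x @lebesgue_measure R]_(z in [set z | A (z.1 * z.2)%R]) (pdf z)%:E =
   \int[lebesgue_measure]_(x in A) ((Num.sqrt pi)^-1%:E *
    vg_kernel 2^-1 (2 * rho * (sX * sY)) (2 * (1 - rho ^+ 2) * (sX * sY) ^+ 2) x))%E.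
Proof.
move=> mA mpdf.
have mI : measurable_fun [set: R] (\1_A : R -> R) by exact: measurable_indic.
have mI0 : measurable_fun [set: R] (\1_(`]0, +oo[ : set R) : R -> R).
  exact: measurable_indic.
pose g (x y : R) : \bar R := (pdf (x, y) * \1_A (x * y))%:E.
have mg : measurable_fun [set: R * R] (fun z => g z.1 z.2).
  apply/measurable_EFinP; apply: measurable_funM.
    by apply: (measurableT_comp mpdf); exact: measurable_fun_pair.
  by apply: (measurableT_comp mI); exact: measurable_funM.
have g0 x y : (0 <= g x y)%E by rewrite lee_fin mulr_ge0 ?binormal_pdf_ge0.
have mgx x : measurable_fun [set: R] (g x).
  exact: (measurableT_comp mg (pair1_measurable x)).
transitivity (\int[lebesgue_measure]_x \int[lebesgue_measure]_y g x y)%E.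
  rewrite -(fubini_tonelli1 (m1 := lebesgue_measure) (m2 := lebesgue_measure)
    (fun z => g z.1 z.2))//.
  rewrite integral_mkcond; apply: eq_integral => -[x y] _.
  have Axy : ((x, y) \in [set z : R * R | A (z.1 * z.2)]) = (x * y \in A).
    by apply/idP/idP; rewrite !inE.
  by rewrite patchE Axy /g indicE; case: ifPn => _; rewrite ?mulr1 ?mulr0.
rewrite ge0_integral_even; last 3 first.
- exact: measurable_ge0_integral.
- by move=> x; exact: integral_ge0.
- move=> x; rewrite ge0_integral_reflection; last 2 first.
  + exact: mgx.
  + by move=> y; exact: g0.
  apply: eq_integral => y _; rewrite /g mulrNN; congr (_ * _)%:E.
  exact: binormal_pdfN.
pose h (x z : R) : R := \1_(`]0, +oo[ : set R) x * (pdf (x, z / x) * x^-1).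
have mh : measurable_fun [set: R * R] (fun u => h u.1 u.2).
  apply: measurable_funM; first exact: (measurableT_comp mI0).
  apply: measurable_funM; last exact: measurable_funV.
  apply: (measurableT_comp mpdf); apply: measurable_fun_pair => //.
  by apply: measurable_funM => //; exact: measurable_funV.
have h0 x z : 0 <= h x z.
  rewrite /h indicE; have [x0|_] := boolP (x \in (`]0, +oo[%classic : set R));
    last by rewrite mul0r.
  move: x0; rewrite inE/= in_itv/= andbT => x0.
  by rewrite mul1r mulr_ge0 ?binormal_pdf_ge0// invr_ge0 ltW.
have mhA : measurable_fun [set: R * R] (fun u => (\1_A u.2)%:E * (h u.1 u.2)%:E)%E.
  by apply/measurable_EFinP; apply: measurable_funM => //; exact: (measurableT_comp mI).
have hA0 x z : (0 <= (\1_A z)%:E * (h x z)%:E)%E.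
  by rewrite -EFinM lee_fin mulr_ge0.
transitivity (2%:E * \int[lebesgue_measure]_x \int[lebesgue_measure]_z
    ((\1_A z)%:E * (h x z)%:E))%E.
  congr (_ * _)%E; rewrite integral_mkcond; apply: eq_integral => x _.
  rewrite patchE /h indicE; case: ifPn => x0; last first.
    by rewrite integral0_eq// => z _; rewrite mul0r mule0.
  move: x0; rewrite inE/= in_itv/= andbT => x0.
  rewrite (ge0_integral_scale (a := x^-1)); last 3 first.
  - by rewrite invr_gt0.
  - exact: mgx.
  - by move=> y; exact: g0.
  rewrite -ge0_integralZl//; last 2 first.
  - by apply: (measurableT_comp (mgx x)); exact: measurable_funM.
  - by rewrite lee_fin invr_ge0 ltW.
  apply: eq_integral => z _; rewrite /g -!EFinM; congr EFin.
  rewrite mulVKf ?gt_eqF// mul1r [x^-1 * z]mulrC; ring.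
rewrite ge0_integral_swap//.
rewrite -ge0_integralZl//; last 2 first.
- apply: (measurable_ge0_integral (f := fun z x => (\1_A z)%:E * (h x z)%:E)%E) => //.
  have ms : measurable_fun [set: R * R] (fun z => (z.2, z.1)) by exact: measurable_fun_pair.
  exact: (measurableT_comp mhA ms).
- by move=> z _; exact: integral_ge0.
rewrite [RHS]integral_mkcond; apply: eq_integral => z _.
rewrite ge0_integralZl//; last 2 first.
- by apply/measurable_EFinP; exact: (measurableT_comp mh (pair2_measurable z)).
- by move=> x _; rewrite lee_fin.
rewrite patchE indicE; case: ifPn => Az; last by rewrite mul0e mule0.
rewrite mul1e -product_densityE; congr (_ * _)%E.
rewrite [RHS]integral_mkcond; apply: eq_integral => x _.
by rewrite patchE /h indicE; case: ifPn => _; rewrite ?mul1r ?mul0r.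
Qed.

End product_of_normals.

(** * Laws of sums of independent variables *)

Section independence.
Context {d : measure_display} {T : measurableType d} {R : realType} (P : probability T R).

(** The measurable structure of [T'] is kept abstract: it is used for the line with the
    structure that carries Lebesgue measure. *)
Lemma ge0_integral_law {d' : measure_display} {T' : measurableType d'}
    (mu : {measure set T' -> \bar R}) (S : T -> T') (f g : T' -> \bar R) :
  measurable_fun [set: T] S ->
  measurable_fun [set: T'] f -> (forall x, 0 <= f x)%E ->
  (forall A, measurable A -> P (S @^-1` A) = \int[mu]_(x in A) f x)%E ->
  measurable_fun [set: T'] g -> (forall x, 0 <= g x)%E ->
  (\int[P]_w g (S w) = \int[mu]_x (g x * f x))%E.
Proof.
move=> mS mf f0 Sf mg g0.
transitivity (\int[pushforward P S]_x g x)%E.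
  by apply/esym/(ge0_integral_image mS).
exact: ge0_integral_density.
Qed.

(** The event [D] carries the information on further variables. On rectangles the two
    sides agree by hypothesis, and [P D] times a product measure is again a product
    measure, so they agree everywhere. *)
Lemma joint_law (S Z : {RV P >-> R}) (D : set T) (B : set (R * R)) :
  measurable D -> measurable B ->
  (forall C E, measurable C -> measurable E ->
    P (S @^-1` C `&` Z @^-1` E `&` D) = P (S @^-1` C) * P (Z @^-1` E) * P D)%E ->
  P ((fun w => (S w, Z w)) @^-1` B `&` D) =
  ((distribution P S \x distribution P Z) B * P D)%E.
Proof.
move=> mD mB indep.
have PDfin : P D \is a fin_num by exact: fin_num_measure.
pose c : {nonneg R} := NngNum (fine_ge0 (measure_ge0 P D)).
have cE : c%:num%:E = P D by rewrite /= fineK.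
pose h w := (S w, Z w).
have mh : measurable_fun [set: T] h by exact: measurable_fun_pair.
rewrite muleC.
transitivity (pushforward (mrestr P mD) h B); first by [].
rewrite -(product_measure_unique (m1 := mscale c (distribution P S)) (m2 := distribution P Z) _ mB).
  rewrite /product_measure1 ge0_integral_mscale//; first by rewrite cE.
  exact: measurable_fun_xsection.
move=> C E mC mE.
transitivity (P (S @^-1` C `&` Z @^-1` E `&` D)); first by [].
by rewrite indep// -cE /mscale /distribution /pushforward /= -[RHS]muleA [RHS]muleC.
Qed.

Lemma density_sum (S Z : {RV P >-> R}) (f g : R -> \bar R) :
  measurable_fun [set: R] f -> measurable_fun [set: R] g ->
  (forall x, 0 <= f x)%E -> (forall x, 0 <= g x)%E ->
  (forall A, measurable A -> P (S @^-1` A) = \int[lebesgue_measure]_(x in A) f x)%E ->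
  (forall A, measurable A -> P (Z @^-1` A) = \int[lebesgue_measure]_(x in A) g x)%E ->
  (forall C E, measurable C -> measurable E ->
    P (S @^-1` C `&` Z @^-1` E) = P (S @^-1` C) * P (Z @^-1` E))%E ->
  forall A, measurable A ->
    (P ((fun w => S w + Z w)%R @^-1` A) =
     \int[lebesgue_measure]_(x in A) convolution f g x)%E.
Proof.
move=> mf mg f0 g0 Sf Zg indep A mA.
have mI : measurable_fun [set: R] (\1_A : R -> R) by exact: measurable_indic.
have mB : measurable [set z : R * R | A (z.1 + z.2)].
  have madd : measurable_fun [set: R * R] (fun z : R * R => z.1 + z.2).
    exact: measurable_funD.
  by have := madd measurableT A mA; rewrite setTI.
have := @joint_law S Z setT _ measurableT mB; rewrite setIT probability_setT mule1.
move=> -> ; last by move=> C E mC mE; rewrite setIT mule1 indep.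
rewrite /product_measure1.
transitivity (\int[distribution P S]_x
  \int[lebesgue_measure]_y ((\1_A y)%:E * g (y - x)%R))%E.
  apply: eq_integral => x _ /=.
  transitivity (P (Z @^-1` (xsection [set z : R * R | A (z.1 + z.2)] x))); first by [].
  rewrite Zg; last exact: measurable_xsection.
  rewrite integral_mkcond [RHS](ge0_integral_translation x); last 2 first.
  - apply: emeasurable_funM; first exact/measurable_EFinP.
    by apply: (measurableT_comp mg); exact: measurable_funB.
  - by move=> y; rewrite mule_ge0// lee_fin.
  apply: eq_integral => y _; rewrite addrK indicE patchE mem_xsection.
  rewrite (_ : (_ \in [set z | A (z.1 + z.2)]) = (y + x \in A)); last first.
    by apply/idP/idP; rewrite !inE /= addrC.
  by case: ifPn => _; rewrite ?mul1e ?mul0e.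
have mk : measurable_fun [set: R * R] (fun z => (\1_A z.2)%:E * g (z.2 - z.1)%R)%E.
  apply: emeasurable_funM; first by apply/measurable_EFinP; exact: (measurableT_comp mI).
  by apply: (measurableT_comp mg); exact: measurable_funB.
have k0 x y : (0 <= (\1_A y)%:E * g (y - x)%R)%E by rewrite mule_ge0// lee_fin.
transitivity (\int[lebesgue_measure]_x
  ((\int[lebesgue_measure]_y ((\1_A y)%:E * g (y - x)%R)) * f x))%E.
  have mG : measurable_fun [set: R]
      (fun x => \int[lebesgue_measure]_y ((\1_A y)%:E * g (y - x)%R))%E.
    exact: measurable_ge0_integral.
  have G0 x : (0 <= \int[lebesgue_measure]_y ((\1_A y)%:E * g (y - x)%R))%E.
    exact: integral_ge0.
  rewrite (ge0_integral_image (mu := P) (h := S))//.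
  have mS : measurable_fun [set: T] (S : T -> R) by exact: measurable_funP.
  exact: (@ge0_integral_law _ (measurableTypeR R) lebesgue_measure S f _ mS).
transitivity (\int[lebesgue_measure]_x \int[lebesgue_measure]_y
   ((\1_A y)%:E * g (y - x)%R * f x))%E.
  apply: eq_integral => x _; rewrite ge0_integralZr//.
  exact: (measurableT_comp mk (pair1_measurable x)).
rewrite ge0_integral_swap; last 2 first.
- by apply: emeasurable_funM => //; exact: (measurableT_comp mf).
- by move=> x y; rewrite mule_ge0.
rewrite [RHS]integral_mkcond; apply: eq_integral => y _; rewrite patchE indicE.
case: ifPn => _; last first.
  by rewrite integral0_eq// => x _; rewrite !mul0e.
by apply: eq_integral => x _; rewrite mul1e muleC.
Qed.

Definition partial_sum n (Z : 'I_n -> {RV P >-> R}) k : {RV P >-> R} :=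
  \sum_(i < n | (i < k)%N) (Z i : {mfun T >-> R}).

Lemma partial_sumE n (Z : 'I_n -> {RV P >-> R}) k w :
  partial_sum Z k w = \sum_(i < n | (i < k)%N) Z i w.
Proof. by rewrite /partial_sum mfun_sum. Qed.

Lemma partial_sumS n (Z : 'I_n -> {RV P >-> R}) (k : 'I_n) w :
  partial_sum Z k.+1 w = partial_sum Z k w + Z k w.
Proof.
rewrite !partial_sumE (bigD1 k)//= addrC; congr (_ + _).
by apply: eq_bigl => i; rewrite ltnS [in RHS]ltn_neqAle andbC -val_eqE.
Qed.

(** Induction on [k]: in the family formed by the partial sum, the next variable and the
    later ones, [joint_law] with [D] the event on the later variables replaces the first
    two by their sum. *)
Lemma partial_sum_independent n (Z : 'I_n -> {RV P >-> R}) :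
  mutually_independent P (fun i => Z i : T -> R) ->
  forall k, (k <= n)%N -> forall (C : set R) (A : 'I_n -> set R),
  measurable C -> (forall i, measurable (A i)) ->
  (P (partial_sum Z k @^-1` C `&`
      \bigcap_(i in [set` [set i : 'I_n | (k <= i)%N]%SET]) (Z i @^-1` A i)) =
   P (partial_sum Z k @^-1` C) *
     \big[*%E/1%E]_(i in [set i : 'I_n | (k <= i)%N]%SET) P (Z i @^-1` A i))%E.
Proof.
move=> hind; elim=> [|k IH] kn C A mC mA.
  have S0 : partial_sum Z 0 @^-1` C = if 0 \in C then setT else set0.
    apply/seteqP; split => w /=; rewrite partial_sumE big_pred0_eq;
    by case: ifPn; rewrite ?inE// notin_setE.
  rewrite S0; case: ifPn => _; last by rewrite set0I measure0 mul0e.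
  by rewrite setTI probability_setT mul1e hind.
pose kk := Ordinal kn.
have mZ i (E : set R) : measurable E -> measurable (Z i @^-1` E).
  by move=> mE; rewrite -[_ @^-1` _]setTI; exact: measurable_funP.
have Jk : [set i : 'I_n | (k <= i)%N]%SET = (kk |: [set i : 'I_n | (k < i)%N])%SET.
  by apply/setP => i; rewrite !inE leq_eqVlt -val_eqE /= eq_sym.
have kJ : kk \notin [set i : 'I_n | (k < i)%N]%SET by rewrite inE ltnn.
have step (A' : 'I_n -> set R) (C' E : set R) : (forall i, measurable (A' i)) ->
    measurable C' -> measurable E ->
    (P (partial_sum Z k @^-1` C' `&` Z kk @^-1` E `&`
      \bigcap_(i in [set` [set i : 'I_n | (k < i)%N]%SET]) (Z i @^-1` A' i)) =
    P (partial_sum Z k @^-1` C') * P (Z kk @^-1` E) *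
      P (\bigcap_(i in [set` [set i : 'I_n | (k < i)%N]%SET]) (Z i @^-1` A' i)))%E.
  move=> mA' mC' mE.
  pose A'' i := if i == kk then E else A' i.
  have mA'' i : measurable (A'' i) by rewrite /A''; case: ifP.
  have A''E (i : 'I_n) : (k < i)%N -> A'' i = A' i.
    by rewrite /A'' => ki; case: eqP => // ik; move: ki; rewrite ik ltnn.
  have capE : \bigcap_(i in [set` [set i : 'I_n | (k <= i)%N]%SET]) (Z i @^-1` A'' i) =
      Z kk @^-1` E `&`
      \bigcap_(i in [set` [set i : 'I_n | (k < i)%N]%SET]) (Z i @^-1` A' i).
    rewrite Jk; apply/seteqP; split => w.
      move=> capw; split.
        by have := capw kk; rewrite /= !inE eqxx /A'' eqxx; exact.
      move=> i /=; rewrite inE => ki; have := capw i.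
      by rewrite /= !inE ki orbT A''E//; exact.
    move=> [Ew capw] i /=; rewrite !inE => /orP[/eqP ->|ki].
      by rewrite /A'' eqxx.
    by rewrite A''E//; apply: capw; rewrite /= inE.
  have := IH (ltnW kn) C' A'' mC' mA''.
  rewrite capE setIA => ->.
  rewrite Jk big_setU1//= {1}/A'' eqxx -muleA hind//; congr (_ * (_ * _))%E.
  by apply: eq_bigr => i; rewrite inE => ki; rewrite A''E.
pose D := \bigcap_(i in [set` [set i : 'I_n | (k < i)%N]%SET]) (Z i @^-1` A i).
have mB : measurable [set z : R * R | C (z.1 + z.2)].
  have madd : measurable_fun [set: R * R] (fun z : R * R => z.1 + z.2).
    exact: measurable_funD.
  by have := madd measurableT C mC; rewrite setTI.
have SB : partial_sum Z k.+1 @^-1` C =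
    (fun w => (partial_sum Z k w, Z kk w)) @^-1` [set z : R * R | C (z.1 + z.2)].
  by apply/seteqP; split => w /=; rewrite (partial_sumS Z kk).
have mD : measurable D by apply: fin_bigcap_measurable => // i _; exact: mZ.
have mST C' E : measurable C' -> measurable E ->
    (P (partial_sum Z k @^-1` C' `&` Z kk @^-1` E `&` setT) =
     P (partial_sum Z k @^-1` C') * P (Z kk @^-1` E) * P setT)%E.
  move=> mC' mE; have := step (fun=> setT) C' E (fun=> measurableT) mC' mE.
  suff -> : \bigcap_(i in [set` [set i : 'I_n | (k < i)%N]%SET]) (Z i @^-1` setT) = setT.
    by [].
  exact/seteqP.
rewrite SB -/D (joint_law mD mB); last by move=> C' E mC' mE; exact: step.
rewrite -[in RHS](setIT (_ @^-1` _)) (joint_law measurableT mB mST).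
by rewrite probability_setT mule1 /D hind.
Qed.

Lemma partial_sum_next_independent n (Z : 'I_n -> {RV P >-> R}) :
  mutually_independent P (fun i => Z i : T -> R) ->
  forall (k : 'I_n) (C E : set R), measurable C -> measurable E ->
  (P (partial_sum Z k @^-1` C `&` Z k @^-1` E) =
   P (partial_sum Z k @^-1` C) * P (Z k @^-1` E))%E.
Proof.
move=> hind k C E mC mE; pose A i := if i == k then E else setT.
have mA i : measurable (A i) by rewrite /A; case: ifP.
have := partial_sum_independent hind (ltnW (ltn_ord k)) mC mA.
rewrite (bigD1 k) ?inE//= {2}/A eqxx big1 ?mule1; last first.
  by move=> i /andP[_ /negbTE ik]; rewrite /A ik preimage_setT probability_setT.
move=> <-; congr (P (_ `&` _)); apply/seteqP; split => w.
  by move=> Ew i _ /=; rewrite /A; case: eqP => // ->.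
by move=> /(_ k) /=; rewrite inE leqnn /A eqxx; exact.
Qed.

End independence.

Lemma density_scaled {d : measure_display} {T : measurableType d} {R : realType}
    (P : probability T R) (W : {RV P >-> R}) (f : R -> \bar R) (c : R) :
  0 < c -> measurable_fun [set: R] f -> (forall x, 0 <= f x)%E ->
  (forall A, measurable A -> P (W @^-1` A) = \int[lebesgue_measure]_(x in A) f x)%E ->
  forall A, measurable A ->
    (P ((fun w => c^-1 * W w)%R @^-1` A) =
     \int[lebesgue_measure]_(x in A) (c%:E * f (c * x)%R))%E.
Proof.
move=> c0 mf f0 lawW A mA.
have mI : measurable_fun [set: R] (\1_A : R -> R) by exact: measurable_indic.
have mcA : measurable [set y : R | A (c^-1 * y)].
  have mc : measurable_fun [set: R] (fun y : R => c^-1 * y) by exact: measurable_funM.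
  by have := mc measurableT A mA; rewrite setTI.
transitivity (P (W @^-1` [set y : R | A (c^-1 * y)])); first by [].
rewrite lawW// integral_mkcond (ge0_integral_scale c0); last 2 first.
- by rewrite -measurable_restrictT//; exact: measurable_funTS.
- by move=> x; rewrite patchE; case: ifP.
rewrite -ge0_integralZl//; last 3 first.
- apply: (measurableT_comp (proj1 (measurable_restrictT _ mcA) (measurable_funTS mf))).
  exact: measurable_funM.
- by move=> x _; rewrite patchE; case: ifP.
- by rewrite lee_fin ltW.
rewrite [RHS]integral_mkcond; apply: eq_integral => x _; rewrite !patchE.
rewrite (_ : (_ \in [set y | A (c^-1 * y)]) = (x \in A)); last first.
  by apply/idP/idP; rewrite !inE /= mulKf// gt_eqF.
by case: ifP; rewrite ?mule0.
Qed.

(** * Variance-gamma laws *)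

Section variance_gamma_law.
Context {R : realType}.
Implicit Types a b m v x : R.

Definition vg_pdf a m v x : \bar R := ((fine (gammae a))^-1%:E * vg_kernel a m v x)%E.

Lemma vg_pdf_ge0 a m v x : (0 <= vg_pdf a m v x)%E.
Proof.
rewrite mule_ge0 ?vg_kernel_ge0// lee_fin invr_ge0 fine_ge0// integral_ge0// => t _.
by rewrite lee_fin gamma_kernel_ge0.
Qed.

Lemma measurable_vg_pdf a m v : measurable_fun [set: R] (vg_pdf a m v).
Proof. by apply: measurable_funeM; exact: measurable_vg_kernel. Qed.

(** Normalizing constants multiply as they should because
    [B (a, b) = Gamma a * Gamma b / Gamma (a + b)]. *)
Lemma vg_pdf_conv a b m v x (ga gb : R) : 0 < v -> 0 < ga -> 0 < gb ->
  gammae a = ga%:E -> gammae b = gb%:E ->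
  convolution (vg_pdf a m v) (vg_pdf b m v) x = vg_pdf (a + b) m v x.
Proof.
move=> v0 ga0 gb0 Ga Gb; have [g g0 [gE BE]] := gammaeD ga0 gb0 Ga Gb.
transitivity ((ga^-1 * gb^-1)%:E * convolution (vg_kernel a m v) (vg_kernel b m v) x)%E.
  rewrite /convolution -ge0_integralZl//; last 3 first.
  - apply: emeasurable_funM; first exact: measurable_vg_kernel.
    by apply: (measurableT_comp (measurable_vg_kernel b m v)); exact: measurable_funB.
  - by move=> y _; rewrite mule_ge0 ?vg_kernel_ge0.
  - by rewrite lee_fin mulr_ge0 ?invr_ge0 ?ltW.
  by apply: eq_integral => y _; rewrite /vg_pdf Ga Gb /= muleACA EFinM.
rewrite vg_kernel_conv// muleA /vg_pdf gE BE /= -EFinM; congr (_%:E * _)%E.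
by field; rewrite !gt_eqF.
Qed.

Lemma sum_vg_law {d : measure_display} {T : measurableType d} (P : probability T R)
    n (Z : 'I_n -> {RV P >-> R}) m v : 0 < v ->
  gammae (2^-1 : R) = (Num.sqrt pi)%:E ->
  mutually_independent P (fun i => Z i : T -> R) ->
  (forall i A, measurable A ->
    P (Z i @^-1` A) = \int[lebesgue_measure]_(x in A) vg_pdf 2^-1 m v x)%E ->
  forall k, (k < n)%N -> forall A, measurable A ->
    (P (partial_sum Z k.+1 @^-1` A) =
     \int[lebesgue_measure]_(x in A) vg_pdf (k.+1%:R / 2) m v x)%E.
Proof.
move=> v0 G1 hind lawZ; elim=> [|k IH] kn A mA.
  rewrite div1r -(lawZ (Ordinal kn) A mA); congr (P _).
  apply/seteqP; split => w /=; rewrite (partial_sumS Z (Ordinal kn)) partial_sumE;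
  by rewrite big_pred0_eq add0r.
pose kk := Ordinal kn.
rewrite (_ : partial_sum Z k.+2 @^-1` A =
    (fun w => partial_sum Z k.+1 w + Z kk w) @^-1` A); last first.
  by apply/seteqP; split => w /=; rewrite (partial_sumS Z kk).
rewrite (density_sum (f := vg_pdf (k.+1%:R / 2) m v) (g := vg_pdf 2^-1 m v))//.
- have [g g0 gE] := gammae_half_nat k G1.
  have kE : k.+2%:R / 2 = k.+1%:R / 2 + 2^-1 :> R.
    by rewrite -[in LHS]natr1 mulrDl div1r.
  have spi : 0 < Num.sqrt (pi : R) by rewrite sqrtr_gt0 pi_gt0.
  rewrite kE; apply: eq_integral => x _.
  exact: (vg_pdf_conv m x v0 g0 spi gE G1).
- exact: measurable_vg_pdf.
- exact: measurable_vg_pdf.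
- by move=> x; exact: vg_pdf_ge0.
- by move=> x; exact: vg_pdf_ge0.
- exact: (IH (ltnW kn)).
- exact: lawZ.
- exact: (partial_sum_next_independent hind kk).
Qed.

End variance_gamma_law.

Section product_of_normals_law.
Context {R : realType} {d : measure_display} {T : measurableType d} (P : probability T R).
Context (X Y : {RV P >-> R}) (sX sY rho : R).
Context (sX0 : 0 < sX) (sY0 : 0 < sY) (rho1 : -1 < rho < 1).
Context (hXY : bivariate_normal P X Y 0 0 sX sY rho).

Let m := 2 * rho * (sX * sY).
Let v := 2 * (1 - rho ^+ 2) * (sX * sY) ^+ 2.

Lemma product_law (A : set R) : measurable A ->
  (P ((fun w => X w * Y w)%R @^-1` A) =
   \int[lebesgue_measure]_(x in A) ((Num.sqrt pi)^-1%:E * vg_kernel 2^-1 m v x))%E.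
Proof.
case: hXY => mpdf _ law mA.
rewrite -product_density//.
have mB : measurable [set z : R * R | A (z.1 * z.2)].
  have mmul : measurable_fun [set: R * R] (fun z : R * R => z.1 * z.2).
    exact: measurable_funM.
  by have := mmul measurableT A mA; rewrite setTI.
by rewrite -law.
Qed.

Lemma v_gt0 : 0 < v.
Proof.
have c0 : 0 < 1 - rho ^+ 2 by case/andP: rho1 => ? ?; nra.
by rewrite /v !mulr_gt0// exprn_gt0// mulr_gt0.
Qed.

(** The law of the product has total mass 1 whereas the kernel has total mass
    [Gamma (1/2)]. *)
Lemma gammae_half : gammae (2^-1 : R) = (Num.sqrt pi)%:E.
Proof.
have spi : 0 < Num.sqrt (pi : R) by rewrite sqrtr_gt0 pi_gt0.
have := product_law measurableT.
rewrite preimage_setT probability_setT ge0_integralZl//; last 2 first.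
- exact: measurable_vg_kernel.
- by move=> x _; exact: vg_kernel_ge0.
rewrite integral_vg_kernel ?v_gt0// => /(congr1 (fun u => (Num.sqrt pi)%:E * u)%E).
by rewrite mule1 muleA -EFinM mulfV ?gt_eqF// mul1e.
Qed.

Lemma product_vg_law (A : set R) : measurable A ->
  (P ((fun w => X w * Y w)%R @^-1` A) =
   \int[lebesgue_measure]_(x in A) vg_pdf 2^-1 m v x)%E.
Proof. by move=> mA; rewrite product_law// /vg_pdf gammae_half. Qed.

End product_of_normals_law.

(** * The density of the mean *)

Section mean_density.
Context {R : realType}.
Context (sX sY rho : R) (n : nat).
Context (sX0 : 0 < sX) (sY0 : 0 < sY) (rho1 : -1 < rho < 1) (n0 : (0 < n)%N).

Let m := 2 * rho * (sX * sY).
Let v := 2 * (1 - rho ^+ 2) * (sX * sY) ^+ 2.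

(** The factor of the Bessel function in the density of the mean. *)
Definition mean_coef (x : R) : R :=
  n%:R `^ ((n%:R + 1) / 2) * 2 `^ ((1 - n%:R) / 2) * `|x| `^ ((n%:R - 1) / 2)
  / ((sX * sY) `^ ((n%:R + 1) / 2) * Num.sqrt (pi * (1 - rho ^+ 2)) * Gamma (n%:R / 2))
  * expR (rho * n%:R * x / (sX * sY * (1 - rho ^+ 2))).

Lemma mean_coef_ge0 x : 0 <= Gamma (n%:R / 2 : R) -> 0 <= mean_coef x.
Proof.
by move=> G0; rewrite !mulr_ge0 ?powR_ge0 ?expR_ge0// invr_ge0 !mulr_ge0 ?powR_ge0 ?sqrtr_ge0.
Qed.

Lemma mean_coef_gt0 x : 0 < Gamma (n%:R / 2 : R) -> x != 0 -> 0 < mean_coef x.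
Proof.
move=> G0 x0.
have c0 : 0 < 1 - rho ^+ 2 by case/andP: rho1 => ? ?; nra.
have nR0 : 0 < n%:R :> R by rewrite ltr0n.
rewrite !mulr_gt0 ?powR_gt0 ?expR_gt0 ?normr_gt0// invr_gt0.
by rewrite !mulr_gt0 ?powR_gt0 ?mulr_gt0// sqrtr_gt0 mulr_gt0 ?pi_gt0.
Qed.

(** Instance of [vg_kernelE] at [n * x] with [r = n |x| / (2 sX sY)]. *)
Lemma vg_pdf_bessel x : x != 0 ->
  (n%:R%:E * vg_pdf (n%:R / 2) m v (n%:R * x) =
  (mean_coef x)%:E * besselKe ((n%:R - 1) / 2) (n%:R * `|x| / (sX * sY * (1 - rho ^+ 2))))%E.
Proof.
move=> x0; have v0 : 0 < v := v_gt0 sX0 sY0 rho1.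
have c0 : 0 < 1 - rho ^+ 2 by case/andP: rho1 => ? ?; nra.
have s0 : 0 < sX * sY by rewrite mulr_gt0.
have nR0 : 0 < n%:R :> R by rewrite ltr0n.
have ax0 : 0 < `|x| by rewrite normr_gt0.
have xx : `|x| ^+ 2 = x ^+ 2 by rewrite real_normK// num_real.
set r := n%:R * `|x| / (2 * (sX * sY)).
have r0 : 0 < r by rewrite divr_gt0 ?mulr_gt0.
set k := n%:R * `|x| / (sX * sY * (1 - rho ^+ 2)).
have kr1 : k / (2 * r) = 1 + m ^+ 2 / (2 * v).
  by rewrite /k /r /m /v; field; rewrite !gt_eqF.
have kr2 : k * r / 2 = (n%:R * x) ^+ 2 / (2 * v).
  by rewrite /k /r /v exprMn -xx; field; rewrite !gt_eqF.
rewrite /vg_pdf (vg_kernelE _ v0 r0 kr1 kr2).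
have -> : n%:R / 2 - 2^-1 = (n%:R - 1) / 2 :> R by field.
rewrite !muleA -!EFinM -GammaE; congr (_%:E * _)%E.
rewrite /mean_coef.
have -> : m * (n%:R * x) / v = rho * n%:R * x / (sX * sY * (1 - rho ^+ 2)).
  by rewrite /m /v; field; rewrite !gt_eqF.
have -> : Num.sqrt (2 * pi * v) = 2 * (sX * sY) * Num.sqrt (pi * (1 - rho ^+ 2)).
  rewrite (_ : 2 * pi * v = (2 * (sX * sY)) ^+ 2 * (pi * (1 - rho ^+ 2))); last by rewrite /v; ring.
  by rewrite sqrtrM ?sqr_ge0// sqrtr_sqr ger0_norm// mulr_ge0// ltW.
set s := sX * sY in s0 *; set nu := (n%:R - 1) / 2.
have powS (y : R) : 0 < y -> y `^ ((n%:R + 1) / 2) = y * y `^ nu.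
  move=> y0; rewrite (_ : (n%:R + 1) / 2 = 1 + nu); last by rewrite /nu; field.
  by rewrite powRD ?powRr1 ?ltW// (gt_eqF y0) implybT.
rewrite !powS// (_ : (1 - n%:R) / 2 = - nu); last by rewrite /nu; field.
rewrite powRN /r powRM; last 2 first.
  by rewrite mulr_ge0 ?ltW.
  by rewrite invr_ge0 mulr_ge0 ?ltW.
rewrite (powRM _ (ltW nR0) (ltW ax0)).
have -> : (2 * s)^-1 `^ nu = (2 `^ nu * s `^ nu)^-1.
  rewrite -[in LHS]powR_inv1 ?mulr_ge0 ?ltW// -powRrM mulN1r powRN.
  by rewrite powRM ?ltW.
rewrite [(_ * Gamma _)^-1]invfM; move: (Gamma (n%:R / 2))^-1 => G.
by field; rewrite !gt_eqF ?powR_gt0// sqrtr_gt0 mulr_gt0 ?pi_gt0.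
Qed.

End mean_density.

Unset Implicit Arguments.
Set Strict Implicit.

Theorem mainTheorem1 (R : realType)
    (d d' : measure_display) (T : measurableType d) (T' : measurableType d')
    (P : probability T R) (P' : probability T' R)
    (X Y : {RV P >-> R}) (sX sY rho : R)
    (hsX : 0 < sX) (hsY : 0 < sY) (hrho : -1 < rho < 1)
    (hXY : bivariate_normal P X Y 0 0 sX sY rho)
    (n : nat) (hn : (1 <= n)%N)
    (Z : 'I_n -> {RV P' >-> R})
    (hlaw : forall i : 'I_n, same_law P' (Z i) P (fun w : T => X w * Y w))
    (hind : mutually_independent P' (fun i : 'I_n => Z i : T' -> R)) :
  has_density P' (@lebesgue_measure R)
    (fun w : T' => n%:R^-1 * \sum_(i < n) Z i w)
    (fun x : R =>
       n%:R `^ ((n%:R + 1) / 2) * 2 `^ ((1 - n%:R) / 2)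
         * `|x| `^ ((n%:R - 1) / 2)
       / ((sX * sY) `^ ((n%:R + 1) / 2) * Num.sqrt (pi * (1 - rho ^+ 2))
          * Gamma (n%:R / 2))
       * expR (rho * n%:R * x / (sX * sY * (1 - rho ^+ 2)))
       * besselK ((n%:R - 1) / 2)
           (n%:R * `|x| / (sX * sY * (1 - rho ^+ 2)))).
Proof.
have n0 : (0 < n%:R :> R) by rewrite ltr0n.
pose m := 2 * rho * (sX * sY).
pose v := 2 * (1 - rho ^+ 2) * (sX * sY) ^+ 2.
have v0 : 0 < v := v_gt0 hsX hsY hrho.
have G1 := gammae_half hsX hsY hrho hXY.
pose nu : R := (n%:R - 1) / 2.
pose k (x : R) := n%:R * `|x| / (sX * sY * (1 - rho ^+ 2)).
pose p x := mean_coef sX sY rho n x * besselK nu (k x).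
pose q (x : R) := (n%:R%:E * vg_pdf (n%:R / 2) m v (n%:R * x)%R)%E.
have Gamma0 : 0 < Gamma (n%:R / 2 : R).
  have [g g0 gE] := gammae_half_nat n.-1 G1.
  by rewrite GammaE -(prednK hn) gE.
have mp : measurable_fun [set: R] p.
  apply: measurable_funM; last first.
    apply: (measurableT_comp (measurable_besselK nu)); apply: measurable_funM => //.
    by apply: measurable_funM => //; exact: normr_measurable.
  apply: measurable_funM; last first.
    by apply: measurableT_comp => //; apply: measurable_funM => //; exact: measurable_funM.
  apply: measurable_funM => //; apply: measurable_funM => //.
  by apply: (measurableT_comp (measurable_powR _)); exact: normr_measurable.
have p0 x : 0 <= p x.
  by apply: mulr_ge0; [exact/mean_coef_ge0/ltW|exact: besselK_ge0].
have mq : measurable_fun [set: R] q.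
  apply: measurable_funeM; apply: (measurableT_comp (measurable_vg_pdf _ m v)).
  exact: measurable_funM.
have q0 x : (0 <= q x)%E by rewrite mule_ge0 ?vg_pdf_ge0// lee_fin.
have lawq A : measurable A ->
    (P' ((fun w : T' => n%:R^-1 * \sum_(i < n) Z i w)%R @^-1` A) =
     \int[lebesgue_measure]_(x in A) q x)%E.
  move=> mA.
  rewrite (_ : (fun w => _) = (fun w => n%:R^-1 * partial_sum Z n w)); last first.
    apply/funext => w; rewrite partial_sumE; congr (_ * _).
    by apply: eq_bigl => i; rewrite ltn_ord.
  apply: (density_scaled (f := vg_pdf (n%:R / 2) m v)) => //.
  - exact: measurable_vg_pdf.
  - by move=> x; exact: vg_pdf_ge0.
  - have kn : (n.-1 < n)%N by rewrite prednK.
    have lawZ i C : measurable C ->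
        (P' (Z i @^-1` C) = \int[lebesgue_measure]_(x in C) vg_pdf 2^-1 m v x)%E.
      by move=> mC; rewrite -(product_vg_law hsX hsY hrho hXY mC); exact: hlaw.
    by have := sum_vg_law v0 G1 hind lawZ kn; rewrite prednK.
have qp : ae_eq lebesgue_measure [set: R] q (EFin \o p).
  have iq : lebesgue_measure.-integrable [set: R] q.
    apply/integrableP; split => //.
    under eq_integral do rewrite gee0_abs//.
    by rewrite -lawq// preimage_setT probability_setT ltry.
  have qE x : x != 0 -> q x \is a fin_num -> q x = (p x)%:E.
    move=> x0; rewrite /q vg_pdf_bessel// /p besselKE -/nu -/(k x).
    have := besselKe_ge0 nu (k x); case: (besselKe nu (k x)) => [b _ _|_|//].
      by rewrite -EFinM.
    by rewrite gt0_muley// lte_fin mean_coef_gt0.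
  (* The exceptional set: 0, and the points where the Bessel integral is infinite. *)
  have [N [mN N0 subN]] := integrable_ae measurableT iq.
  exists ([set 0] `|` N); split.
  - exact: measurableU.
  - by apply: null_set_setU => //; exact: lebesgue_measure_set1.
  - move=> x /= /not_implyP[_ qpx]; have [->|x0] := eqVneq x 0; [by left|right].
    by apply: subN => /= /(_ Logic.I) qfin; apply: qpx; exact: qE.
split.
- exact: mp.
- exact: p0.
- move=> A mA; rewrite /pushforward lawq//.
  apply: ae_eq_integral => //.
  - exact: measurable_funTS.
  - by apply/measurable_EFinP; exact: measurable_funTS.
  - exact: ae_eq_subset qp.
Qed.
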